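(* Let $\mathcal{A}$ be an additive Hom-finite Krull-Schmidt $k$-category for which there is a positive integer $n\ge 2$ such that each indecomposable object of $\mathbf{C}^b(\mathcal{A})$ is a shift of an indecomposable object of $\mathbf{C}_{[1,n]}(\mathcal{A})$. Then for each positive integer $m$ the compression functor $\mathcal{F}_m:\mathbf{C}^b(\mathcal{A})\to\mathbf{C}_{\equiv m}(\mathcal{A})$ is a Galois $G$-covering, where $G$ is the cyclic group generated by the shift $[m]$ acting on $\mathbf{C}^b(\mathcal{A})$.
   Context: $k$ is a commutative ring. $\mathbf{C}^b(\mathcal{A})$ is the category of bounded cochain complexes over $\mathcal{A}$; $\mathbf{C}_{[1,n]}(\mathcal{A})$ is the full subcategory of complexes with $X^i=0$ for $i\notin[1,n]$. The shift $X[t]$ has $X[t]^i=X^{i+t}$ and differential $(-1)^td_X^{i+t}$. $\mathbf{C}_{\equiv m}(\mathcal{A})$ is the category of $m$-periodic complexes: complexes $X=(X^i,d_X^i)_{i\in\mathbb{Z}}$ with $X^i=X^j$ and $d_X^i=d_X^j$ whenever $i\equiv j\pmod m$; morphisms are chain maps $(f^i)$ with $f^i=f^j$ whenever $i\equiv j\pmod m$. The compression functor $\mathcal{F}_m$ is given by $\mathcal{F}_m(X)^i=\bigoplus_{t\in\mathbb{Z}}X^{i+tm}$ with diagonal differential with components $d_X^{i+tm}$, and $\mathcal{F}_m(f)^i$ is diagonal with components $f^{i+tm}$. Galois $G$-coverings (in the sense of Bautista-Liu). Let $\mathcal{C},\mathcal{D}$ be additive $k$-linear categories, considered skeletal (isomorphic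 objects are identified), and let a group $G$ act on $\mathcal{C}$. The action is admissible if it is free ($g\cdot X\not\cong X$ for $X$ indecomposable and $g\ne e$) and locally bounded (for $X,Y$ indecomposable, $\mathcal{C}(X,g\cdot Y)=0$ for all but finitely many $g\in G$). A $G$-stabilizer of a functor $F:\mathcal{C}\to\mathcal{D}$ is a family $\delta=(\delta_g)_{g\in G}$ of natural isomorphisms $\delta_g:F\circ g\to F$, with components $\delta_{g,X}:F(g\cdot X)\to F(X)$, such that $\delta_{h,X}\circ\delta_{g,h\cdot X}=\delta_{gh,X}$ for all $g,h\in G$, $X\in\mathcal{C}$. $F$ is a $G$-precovering if it has a $G$-stabilizer $\delta$ such that for all $X,Y\in\mathcal{C}$ the maps $\bigoplus_{g\in G}\mathcal{C}(X,g\cdot Y)\to\mathcal{D}(F(X),F(Y))$, $(u_g)\mapsto\sum_g\delta_{g,Y}\circ F(u_g)$, and $\bigoplus_{g\in G}\mathcal{C}(g\cdot X,Y)\to\mathcal{D}(F(X),F(Y))$, $(v_g)\mapsto\sum_gF(v_g)\circ\delta_{g,X}^{-1}$, are isomorphisms. If $G$ acts admissibly on $\mathcal{C}$, a $G$-precovering $F$ is a Galois $G$-covering if: (a) $F$ is almost dense, i.e. each indecomposable object of $\mathcal{D}$ is isomorphic to an object in the image of $F$; (b) if $X\in\mathcal{C}$ is indecomposable then $F(X)$ is indecomposable; (c) if $X,Y\in\mathcal{C}$ are indecomposable with $F(X)\cong F(Y)$, then there is $g\in G$ with $Y\cong g\cdot X$. *)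

(* Defs.v *)
From HB Require Import structures.
From mathcomp Require Import all_boot all_order all_algebra.
From mathcomp Require Import zify.
From mathcomp Require Import boolp classical_sets cardinality fsbigop.
Set Implicit Arguments.
Unset Strict Implicit.
Unset Printing Implicit Defensive.
Import Order.TTheory GRing.Theory Num.Theory.
Local Open Scope ring_scope.

Reserved Notation "g \oc f" (at level 40, left associativity).

Record kcat (k : comPzRingType) := KCat {
  obj :> Type;
  hom : obj -> obj -> lmodType k;
  idm : forall X, hom X X;
  mcomp : forall X Y Z, hom Y Z -> hom X Y -> hom X Z;
  mcomp1m : forall X Y (f : hom X Y), mcomp (idm Y) f = f;
  mcompm1 : forall X Y (f : hom X Y), mcomp f (idm X) = f;
  mcompA : forall X Y Z T (h : hom Z T) (g : hom Y Z) (f : hom X Y),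
    mcomp h (mcomp g f) = mcomp (mcomp h g) f;
  mcomp_linr : forall X Y Z (g : hom Y Z), linear (@mcomp X Y Z g);
  mcomp_linl : forall X Y Z (f : hom X Y),
    linear (fun g : hom Y Z => mcomp g f)
}.
Arguments idm {k C} X : rename.
Arguments mcomp {k C X Y Z} g f : rename.
Notation "g \oc f" := (mcomp g f) : ring_scope.

(* A morphism together with its endpoints: [Arrow f = Arrow g] expresses that
   f and g are the same morphism, including the equality of their sources and
   targets, when their types are not convertible. *)
Record arrow (k : comPzRingType) (C : kcat k) := Arrow {
  src : C; tgt : C; arr : hom src tgt }.
Arguments Arrow {k C src tgt} arr.

Record kfunctor (k : comPzRingType) (C D : kcat k) := KFunctor {
  fobj :> C -> D;
  fmap : forall X Y : C, hom X Y -> hom (fobj X) (fobj Y);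
  fmap1 : forall X : C, fmap (idm X) = idm (fobj X);
  fmapM : forall (X Y Z : C) (g : hom Y Z) (f : hom X Y),
    fmap (g \oc f) = fmap g \oc fmap f;
  fmap_lin : forall X Y : C, linear (@fmap X Y)
}.
Arguments fmap {k C D} F {X Y} f : rename.

(* S is the direct sum of the X i for i in P, where all but finitely many of
   these are zero: the last axiom forces X i = 0 for i in P outside [ds_supp].
   The data at indices outside P is irrelevant. *)
Record dirsum (k : comPzRingType) (C : kcat k) (I : eqType) (P : pred I)
    (X : I -> C) (S : C) := DirSum {
  ds_inj : forall i, hom (X i) S;
  ds_prj : forall i, hom S (X i);
  ds_supp : seq I;
  ds_supp_uniq : uniq ds_supp;
  ds_suppP : {subset ds_supp <= P};
  ds_prj_inj : forall i, P i -> ds_prj i \oc ds_inj i = idm (X i);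
  ds_prj_inj0 : forall i j, P i -> P j -> i != j -> ds_prj j \oc ds_inj i = 0;
  ds_sum : \sum_(i <- ds_supp) ds_inj i \oc ds_prj i = idm S
}.

Section Notions.
Variables (k : comPzRingType).

Section Category.
Variable C : kcat k.
Implicit Types X Y Z : C.

Definition is_iso X Y (f : hom X Y) : Prop :=
  exists g : hom Y X, g \oc f = idm X /\ f \oc g = idm Y.

Definition isom X Y : Prop := exists f : hom X Y, is_iso f.

Definition is_zero X : Prop := idm X = 0.

Definition is_dirsum (I : eqType) (Y : I -> C) X : Prop :=
  inhabited (dirsum predT Y X).

Definition is_additive : Prop :=
  forall (n : nat) (Y : 'I_n -> C), exists X, is_dirsum Y X.

Definition indecomposable X : Prop :=
  ~ is_zero X /\
  forall Y : bool -> C, is_dirsum Y X -> is_zero (Y true) \/ is_zero (Y false).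

Definition local_end X : Prop :=
  idm X <> 0 /\ forall f : hom X X, is_iso f \/ is_iso (idm X - f).

Definition krull_schmidt : Prop :=
  forall X, exists (n : nat) (Y : 'I_n -> C),
    (forall i, local_end (Y i)) /\ is_dirsum Y X.

End Category.

(* The lengths of strict chains of submodules M 0 < ... < M r are bounded. *)
Definition finite_length (V : lmodType k) : Prop :=
  exists N : nat, forall (r : nat) (M : nat -> {pred V}),
    (forall i, (i <= r)%N -> submod_closed (M i)) ->
    (forall i, (i < r)%N -> {subset M i <= M i.+1} /\
       exists v, v \in M i.+1 /\ v \notin M i) ->
    (r <= N)%N.

Definition hom_finite (C : kcat k) : Prop :=
  forall X Y : C, finite_length (hom X Y).

End Notions.

Section FullSubcategory.
Variables (k : comPzRingType) (C : kcat k) (P : C -> Prop).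

Definition full_hom (X Y : {X : C | P X}) : lmodType k := hom (sval X) (sval Y).

Definition full_subcat : kcat k.
Proof.
refine (@KCat k {X : C | P X} full_hom (fun X => idm (sval X))
  (fun X Y Z (g : full_hom Y Z) (f : full_hom X Y) => g \oc f) _ _ _ _ _).
- by move=> X Y f; exact: mcomp1m.
- by move=> X Y f; exact: mcompm1.
- by move=> X Y Z T h g f; exact: mcompA.
- by move=> X Y Z g; exact: mcomp_linr.
- by move=> X Y Z f; exact: mcomp_linl.
Defined.

End FullSubcategory.

Section Galois.
Variables (k : comPzRingType).

(* A (strict) action of G on C by k-linear automorphisms. *)
Record gaction (G : groupType) (C : kcat k) := GAction {
  gact :> G -> kfunctor C C;
  gact1 : forall (X Y : C) (f : hom X Y), Arrow (fmap (gact 1%g) f) = Arrow f;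
  gactM : forall (g h : G) (X Y : C) (f : hom X Y),
    Arrow (fmap (gact g) (fmap (gact h) f)) = Arrow (fmap (gact (g * h)%g) f)
}.

Definition admissible (G : groupType) (C : kcat k) (a : gaction G C) : Prop :=
  (forall (X : C) (g : G), indecomposable X -> g <> 1%g -> ~ isom (a g X) X) /\
  (forall X Y : C, indecomposable X -> indecomposable Y ->
     finite_set [set g : G | exists f : hom X (a g Y), f <> 0]).

Record stabilizer (G : groupType) (C D : kcat k) (a : gaction G C)
    (F : kfunctor C D) := Stabilizer {
  stab : forall (g : G) (X : C), hom (F (a g X)) (F X);
  stabV : forall (g : G) (X : C), hom (F X) (F (a g X));
  stabK : forall g X, stabV g X \oc stab g X = idm (F (a g X));
  stabVK : forall g X, stab g X \oc stabV g X = idm (F X);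
  stab_nat : forall g (X Y : C) (f : hom X Y),
    stab g Y \oc fmap F (fmap (a g) f) = fmap F f \oc stab g X;
  stabM : forall g h X,
    Arrow (stab h X \oc stab g (a h X)) = Arrow (stab (g * h)%g X)
}.

(* The elements of the (external) direct sum of the modules M i. *)
Record finfam (I : choiceType) (M : I -> lmodType k) := FinFam {
  fam :> forall i, M i;
  fam_fin : finite_set [set i | fam i <> 0]
}.

Section Precovering.
Variables (G : groupType) (C D : kcat k) (a : gaction G C) (F : kfunctor C D).

Definition precov_l (delta : stabilizer a F) (X Y : C)
    (u : finfam (fun g : G => hom X (a g Y))) : hom (F X) (F Y) :=
  \sum_(g \in [set: G]) (stab delta g Y \oc fmap F (u g)).

Definition precov_r (delta : stabilizer a F) (X Y : C)
    (v : finfam (fun g : G => hom (a g X) Y)) : hom (F X) (F Y) :=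
  \sum_(g \in [set: G]) (fmap F (v g) \oc stabV delta g X).

Definition precovering : Prop :=
  exists delta : stabilizer a F, forall X Y : C,
    bijective (@precov_l delta X Y) /\ bijective (@precov_r delta X Y).

Definition almost_dense : Prop :=
  forall Z : D, indecomposable Z -> exists X : C, isom (F X) Z.

Definition galois_covering : Prop :=
  [/\ admissible a, precovering, almost_dense,
      (forall X : C, indecomposable X -> indecomposable (F X)) &
      (forall X Y : C, indecomposable X -> indecomposable Y ->
         isom (F X) (F Y) -> exists g : G, isom Y (a g X))].

End Precovering.
End Galois.

Section Basics.
Variables (k : comPzRingType) (C : kcat k).
Implicit Types X Y Z : C.

Lemma mcompDr X Y Z (g : hom Y Z) (f f' : hom X Y) :
  g \oc (f + f') = g \oc f + g \oc f'.
Proof. by have := mcomp_linr (X := X) g 1 f f'; rewrite !scale1r. Qed.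

Lemma mcompDl X Y Z (g g' : hom Y Z) (f : hom X Y) :
  (g + g') \oc f = g \oc f + g' \oc f.
Proof. by have := mcomp_linl (Z := Z) f 1 g g'; rewrite !scale1r. Qed.

Lemma mcomp0r X Y Z (g : hom Y Z) : g \oc (0 : hom X Y) = 0.
Proof. by apply: (addrI (g \oc 0)); rewrite -mcompDr !addr0. Qed.

Lemma mcomp0l X Y Z (f : hom X Y) : (0 : hom Y Z) \oc f = 0.
Proof. by apply: (addrI (0 \oc f)); rewrite -mcompDl !addr0. Qed.

Lemma mcompZr X Y Z (g : hom Y Z) (f : hom X Y) c :
  g \oc (c *: f) = c *: (g \oc f).
Proof. by have := mcomp_linr g c f 0; rewrite !addr0 mcomp0r addr0. Qed.

Lemma mcompZl X Y Z (g : hom Y Z) (f : hom X Y) c :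
  (c *: g) \oc f = c *: (g \oc f).
Proof. by have := mcomp_linl f c g 0; rewrite !addr0 mcomp0l addr0. Qed.

Lemma mcompNr X Y Z (g : hom Y Z) (f : hom X Y) : g \oc (- f) = - (g \oc f).
Proof. by rewrite -scaleN1r mcompZr scaleN1r. Qed.

Lemma mcompNl X Y Z (g : hom Y Z) (f : hom X Y) : (- g) \oc f = - (g \oc f).
Proof. by rewrite -scaleN1r mcompZl scaleN1r. Qed.

Lemma mcomp_sumr X Y Z (g : hom Y Z) (J : Type) (r : seq J) (f : J -> hom X Y) :
  g \oc (\sum_(j <- r) f j) = \sum_(j <- r) g \oc f j.
Proof.
by elim: r => [|j r IH]; rewrite ?big_nil ?mcomp0r// !big_cons mcompDr IH.
Qed.

Lemma mcomp_suml X Y Z (f : hom X Y) (J : Type) (r : seq J) (g : J -> hom Y Z) :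
  (\sum_(j <- r) g j) \oc f = \sum_(j <- r) g j \oc f.
Proof.
by elim: r => [|j r IH]; rewrite ?big_nil ?mcomp0l// !big_cons mcompDl IH.
Qed.

Lemma is_zero_tgt X Y (f : hom X Y) : is_zero Y -> f = 0.
Proof. by move=> Y0; rewrite -(mcomp1m f) Y0 mcomp0l. Qed.

Lemma is_zero_src X Y (f : hom X Y) : is_zero X -> f = 0.
Proof. by move=> X0; rewrite -(mcompm1 f) X0 mcomp0r. Qed.

Definition hcast X X' Y Y' (eX : X = X') (eY : Y = Y') (f : hom X Y) :
  hom X' Y' := match eX, eY with erefl, erefl => f end.

Lemma ArrowP X X' Y Y' (f : hom X Y) (f' : hom X' Y') :
  Arrow f = Arrow f' ->
  exists (eX : X = X') (eY : Y = Y'), f' = hcast eX eY f.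
Proof.
have gen (u v : arrow C) (e : u = v) :
    arr v = hcast (congr1 (@src _ _) e) (congr1 (@tgt _ _) e) (arr u).
  by case: _ / e.
by move=> e; have := gen _ _ e; exists (congr1 (@src _ _) e), (congr1 (@tgt _ _) e).
Qed.

Lemma Arrow_inj X Y (f f' : hom X Y) : Arrow f = Arrow f' -> f = f'.
Proof.
move=> /ArrowP[eX [eY ->]].
by rewrite (Prop_irrelevance eX erefl) (Prop_irrelevance eY erefl).
Qed.

Lemma Arrow_lin X X' Y Y' (c : k) (f g : hom X Y) (f' g' : hom X' Y') :
  Arrow f = Arrow f' -> Arrow g = Arrow g' ->
  Arrow (c *: f + g) = Arrow (c *: f' + g').
Proof.
move=> /ArrowP[eX [eY ->]]; case: _ / eX f' g' => f' g'.
case: _ / eY f' g' => f' g' /=.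
by move=> /Arrow_inj ->.
Qed.

Lemma Arrow_idm X X' : X = X' -> Arrow (idm X) = Arrow (idm X').
Proof. by move=> ->. Qed.

Lemma Arrow_comp X X' Y Y' Z Z' (g : hom Y Z) (g' : hom Y' Z')
    (f : hom X Y) (f' : hom X' Y') :
  Arrow g = Arrow g' -> Arrow f = Arrow f' -> Arrow (g \oc f) = Arrow (g' \oc f').
Proof.
move=> /ArrowP[eY [eZ ->]]; case: _ / eY f' g' => f' g'.
case: _ / eZ g' => g' /= /ArrowP[eX [eY ->]].
rewrite (Prop_irrelevance eY erefl) /=.
by case: _ / eX f'.
Qed.

Lemma Arrow_src X X' Y Y' (f : hom X Y) (f' : hom X' Y') :
  Arrow f = Arrow f' -> X = X'.
Proof. by case/ArrowP. Qed.

End Basics.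

Section Complexes.
Variables (k : comPzRingType) (A : kcat k).

(* The differential d^i is [cd i (i + 1)]; the other [cd i j] are zero. *)
Record complex := Complex {
  cobj :> int -> A;
  cd : forall i j, hom (cobj i) (cobj j);
  cd_shape : forall i j : int, j != i + 1 -> cd i j = 0;
  cd_sq : forall i j l, cd j l \oc cd i j = 0
}.

Record chain_map (X Y : complex) := ChainMap {
  cmap :> forall i, hom (X i) (Y i);
  cmap_comm : forall i j, cmap j \oc cd X i j = cd Y i j \oc cmap i
}.

Lemma chain_map_eq X Y (f g : chain_map X Y) : (forall i, f i = g i) -> f = g.
Proof.
case: f g => [f fP] [g gP] /= fg; have e : f = g by apply: functional_extensionality_dep.
by case: _ / e gP {fg} => gP; rewrite (Prop_irrelevance fP gP).
Qed.

HB.instance Definition _ X Y := gen_eqMixin (chain_map X Y).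
HB.instance Definition _ X Y := gen_choiceMixin (chain_map X Y).

Section Ops.
Variables X Y : complex.
Implicit Types f g : chain_map X Y.

Definition cm_zero : chain_map X Y.
Proof. by exists (fun i => 0) => i j; rewrite mcomp0l mcomp0r. Defined.

Definition cm_add f g : chain_map X Y.
Proof.
by exists (fun i => f i + g i) => i j; rewrite mcompDl mcompDr !cmap_comm.
Defined.

Definition cm_opp f : chain_map X Y.
Proof. by exists (fun i => - f i) => i j; rewrite mcompNl mcompNr cmap_comm. Defined.

Definition cm_scale (c : k) f : chain_map X Y.
Proof.
by exists (fun i => c *: f i) => i j; rewrite mcompZl mcompZr cmap_comm.
Defined.

Lemma cm_addA : associative cm_add.
Proof. by move=> f g h; apply: chain_map_eq => i /=; rewrite addrA. Qed.
Lemma cm_addC : commutative cm_add.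
Proof. by move=> f g; apply: chain_map_eq => i /=; rewrite addrC. Qed.
Lemma cm_add0 : left_id cm_zero cm_add.
Proof. by move=> f; apply: chain_map_eq => i /=; rewrite add0r. Qed.
Lemma cm_addN : left_inverse cm_zero cm_opp cm_add.
Proof. by move=> f; apply: chain_map_eq => i /=; rewrite addNr. Qed.

HB.instance Definition _ :=
  GRing.isZmodule.Build (chain_map X Y) cm_addA cm_addC cm_add0 cm_addN.

Lemma cm_scaleA c d f : cm_scale c (cm_scale d f) = cm_scale (c * d) f.
Proof. by apply: chain_map_eq => i /=; rewrite scalerA. Qed.
Lemma cm_scale1 : left_id 1 cm_scale.
Proof. by move=> f; apply: chain_map_eq => i /=; rewrite scale1r. Qed.
Lemma cm_scaleDr : right_distributive cm_scale +%R.
Proof. by move=> c f g; apply: chain_map_eq => i /=; rewrite scalerDr. Qed.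
Lemma cm_scaleDl f : {morph cm_scale^~ f : c d / c + d}.
Proof. by move=> c d; apply: chain_map_eq => i /=; rewrite scalerDl. Qed.

HB.instance Definition _ := GRing.Zmodule_isLmodule.Build k (chain_map X Y)
  cm_scaleA cm_scale1 cm_scaleDr cm_scaleDl.

End Ops.

Definition cm_id (X : complex) : chain_map X X.
Proof. by exists (fun i => idm (X i)) => i j; rewrite mcomp1m mcompm1. Defined.

Definition cm_comp (X Y Z : complex) (g : chain_map Y Z) (f : chain_map X Y) :
  chain_map X Z.
Proof.
exists (fun i => g i \oc f i) => i j.
by rewrite -mcompA cmap_comm mcompA cmap_comm -mcompA.
Defined.

Definition complexes : kcat k.
Proof.
refine (@KCat k complex (fun X Y => chain_map X Y : lmodType k) cm_id cm_comp
  _ _ _ _ _).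
- by move=> X Y f; apply: chain_map_eq => i; exact: mcomp1m.
- by move=> X Y f; apply: chain_map_eq => i; exact: mcompm1.
- by move=> X Y Z T h g f; apply: chain_map_eq => i; exact: mcompA.
- by move=> X Y Z g c f f'; apply: chain_map_eq => i; exact: mcomp_linr.
- by move=> X Y Z f c g g'; apply: chain_map_eq => i; exact: mcomp_linl.
Defined.

Definition bounded (X : complex) : Prop :=
  exists a b : int, forall i : int, i < a \/ b < i -> is_zero (X i).

Definition bounded_complexes : kcat k := full_subcat (C := complexes) bounded.

Definition complexes_1n (n : nat) : kcat k :=
  full_subcat (C := bounded_complexes)
    (fun X => forall i : int, ~~ (1 <= i <= n%:Z) -> is_zero (sval X i)).

Section Shift.

Definition shift_sign (t : int) : k := (-1) ^+ `|t|%N.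

Lemma shift_signD s t : shift_sign (s + t) = shift_sign s * shift_sign t.
Proof.
rewrite /shift_sign -exprD -[LHS]signr_odd -[RHS]signr_odd.
by congr (_ ^+ nat_of_bool _); lia.
Qed.

Definition shift_obj (t : int) (X : complex) : complex.
Proof.
exists (fun i => X (i + t)) (fun i j => shift_sign t *: cd X (i + t) (j + t)).
- move=> i j ji; rewrite cd_shape ?scaler0//.
  by rewrite addrAC (inj_eq (addIr _)).
- by move=> i j l; rewrite mcompZl mcompZr cd_sq !scaler0.
Defined.

Definition shift_map (t : int) (X Y : complex) (f : chain_map X Y) :
  chain_map (shift_obj t X) (shift_obj t Y).
Proof.
by exists (fun i => f (i + t)) => i j /=; rewrite mcompZl mcompZr cmap_comm.
Defined.

Lemma bounded_shift t X : bounded X -> bounded (shift_obj t X).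
Proof.
move=> [a [b h]]; exists (a - t), (b - t) => i ih; apply: h.
by case: ih => ih; [left; rewrite -ltrBrDr | right; rewrite -ltrBlDr].
Qed.

Definition shift (t : int) : kfunctor bounded_complexes bounded_complexes.
Proof.
refine (@KFunctor k bounded_complexes bounded_complexes
  (fun X => exist _ (shift_obj t (sval X)) (bounded_shift t (svalP X)))
  (fun X Y (f : chain_map (sval X) (sval Y)) => shift_map t f) _ _ _).
- by move=> X; apply: chain_map_eq.
- by move=> X Y Z g f; apply: chain_map_eq.
- by move=> X Y c f g; apply: chain_map_eq.
Defined.

(* The underlying data of a morphism of complexes, without the axioms; used to
   prove that [shift s \o shift t] and [shift (s + t)] are equal on the nose. *)
Record raw_map := RawMap {
  rX : int -> A; rdX : forall i j, hom (rX i) (rX j);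
  rY : int -> A; rdY : forall i j, hom (rY i) (rY j);
  rf : forall i, hom (rX i) (rY i)
}.

Definition raw_of (X Y : bounded_complexes) (f : hom X Y) : raw_map :=
  RawMap (cd (sval X)) (cd (sval Y)) (f : chain_map (sval X) (sval Y)).

Definition raw_arrow (r : raw_map) sX qX bX sY qY bY cf :
    arrow bounded_complexes :=
  let X := @Complex (rX r) (rdX r) sX qX in
  let Y := @Complex (rY r) (rdY r) sY qY in
  @Arrow k bounded_complexes (exist bounded X bX) (exist bounded Y bY)
    (@ChainMap X Y (rf r) cf).

Lemma raw_arrow_eq (r r' : raw_map) : r = r' ->
  forall sX qX bX sY qY bY cf sX' qX' bX' sY' qY' bY' cf',
  @raw_arrow r sX qX bX sY qY bY cf = @raw_arrow r' sX' qX' bX' sY' qY' bY' cf'.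
Proof.
case: _ / => sX qX bX sY qY bY cf sX' qX' bX' sY' qY' bY' cf'.
have ? : sX = sX' by [exact: Prop_irrelevance]; subst sX'.
have ? : qX = qX' by [exact: Prop_irrelevance]; subst qX'.
have ? : bX = bX' by [exact: Prop_irrelevance]; subst bX'.
have ? : sY = sY' by [exact: Prop_irrelevance]; subst sY'.
have ? : qY = qY' by [exact: Prop_irrelevance]; subst qY'.
have ? : bY = bY' by [exact: Prop_irrelevance]; subst bY'.
by have ? : cf = cf' by [exact: Prop_irrelevance]; subst cf'.
Qed.

Lemma Arrow_raw (X Y X' Y' : bounded_complexes) (f : hom X Y) (f' : hom X' Y') :
  raw_of f = raw_of f' -> Arrow f = Arrow f'.
Proof.
case: X Y X' Y' f f' => [[oX dX sX qX] bX] [[oY dY sY qY] bY].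
move=> [[oX' dX' sX' qX'] bX'] [[oY' dY' sY' qY'] bY'] [f cf] [f' cf'].
by move=> e; exact: (raw_arrow_eq e).
Qed.

Definition shift_raw (X Y : complex) (f : chain_map X Y) (p : int -> int) (c : k) :=
  @RawMap (fun i => X (p i)) (fun i j => c *: cd X (p i) (p j))
          (fun i => Y (p i)) (fun i j => c *: cd Y (p i) (p j))
          (fun i => f (p i)).

Lemma RawMap_eq (oX oY : int -> A) dX dX' dY dY' (f : forall i, hom (oX i) (oY i)) :
  (forall i j, dX i j = dX' i j) -> (forall i j, dY i j = dY' i j) ->
  RawMap dX dY f = RawMap dX' dY' f.
Proof.
move=> eX eY.
have -> : dX = dX' by do 2!apply: functional_extensionality_dep => ?.
by have -> : dY = dY' by do 2!apply: functional_extensionality_dep => ?.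
Qed.

Lemma shift0 (X Y : bounded_complexes) (f : hom X Y) :
  Arrow (fmap (shift 0) f) = Arrow f.
Proof.
apply: Arrow_raw.
rewrite -[LHS]/(shift_raw f (fun i => i + 0) 1).
have -> : (fun i : int => i + 0) = id by apply: functional_extensionality_dep => i; rewrite addr0.
by apply: RawMap_eq => i j; rewrite scale1r.
Qed.

Lemma shiftD (s t : int) (X Y : bounded_complexes) (f : hom X Y) :
  Arrow (fmap (shift s) (fmap (shift t) f)) = Arrow (fmap (shift (s + t)) f).
Proof.
apply: Arrow_raw.
rewrite -[RHS]/(shift_raw f (fun i => i + (s + t)) (shift_sign (s + t))).
have -> : (fun i : int => i + (s + t)) = (fun i => i + s + t).
  by apply: functional_extensionality_dep => i; rewrite addrA.
by apply: RawMap_eq => i j; rewrite shift_signD -scalerA.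
Qed.

End Shift.
End Complexes.

(* The infinite cyclic group, written multiplicatively. *)
Definition zgroup : Type := int.
HB.instance Definition _ := Choice.copy zgroup int.
HB.instance Definition _ := isGroup.Build zgroup
  (@addrA int) (@add0r int) (@addr0 int) (@addNr int) (@addrN int).

Section ShiftAction.
Variables (k : comPzRingType) (A : kcat k) (m : nat).

Definition shift_action : gaction zgroup (bounded_complexes A).
Proof.
refine (@GAction k zgroup (bounded_complexes A)
  (fun t => shift A ((t : int) * m%:Z)) _ _).
- by move=> X Y f; rewrite mul0r; exact: shift0.
- by move=> g h X Y f; rewrite shiftD -mulrDl.
Defined.

End ShiftAction.

Section Periodic.
Variables (k : comPzRingType) (A : kcat k) (m : nat).

Record pcomplex := PComplex {
  pc :> complex A;
  pc_per : forall i j : int, (i = j %[mod m])%Z ->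
    Arrow (cd pc i (i + 1)) = Arrow (cd pc j (j + 1))
}.

Record pmap (X Y : pcomplex) := PMap {
  pm :> chain_map X Y;
  pm_per : forall i j : int, (i = j %[mod m])%Z -> Arrow (pm i) = Arrow (pm j)
}.

Lemma pmap_eq X Y (f g : pmap X Y) : pm f = pm g -> f = g.
Proof.
case: f g => [f fP] [g gP] /= fg; case: _ / fg gP => gP.
by rewrite (Prop_irrelevance fP gP).
Qed.

Lemma pc_obj (X : pcomplex) (i j : int) : (i = j %[mod m])%Z -> X i = X j.
Proof. by move=> ij; exact: (Arrow_src (pc_per X ij)). Qed.

HB.instance Definition _ X Y := gen_eqMixin (pmap X Y).
HB.instance Definition _ X Y := gen_choiceMixin (pmap X Y).

Section Ops.
Variables X Y : pcomplex.
Implicit Types f g : pmap X Y.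

Lemma Arrow_pm0 (i j : int) : (i = j %[mod m])%Z ->
  Arrow (0 : hom (X i) (Y i)) = Arrow (0 : hom (X j) (Y j)).
Proof. by move=> ij; rewrite (pc_obj X ij) (pc_obj Y ij). Qed.

Definition pm_lin (c : k) f g : pmap X Y.
Proof.
exists (c *: (f : chain_map X Y) + (g : chain_map X Y)) => i j ij.
by apply: Arrow_lin; exact: pm_per.
Defined.

Definition pm_zero : pmap X Y.
Proof. by exists (0 : chain_map X Y) => i j ij; exact: Arrow_pm0. Defined.

Definition pm_add f g := pm_lin 1 f g.
Definition pm_opp f := pm_lin (-1) f pm_zero.
Definition pm_scale c f := pm_lin c f pm_zero.

Lemma pm_addE f g : pm (pm_add f g) = pm f + pm g.
Proof. by rewrite /= scale1r. Qed.
Lemma pm_oppE f : pm (pm_opp f) = - pm f.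
Proof. by rewrite /= scaleN1r addr0. Qed.
Lemma pm_scaleE c f : pm (pm_scale c f) = c *: pm f.
Proof. by rewrite /= addr0. Qed.

Lemma pm_addA : associative pm_add.
Proof. by move=> f g h; apply: pmap_eq; rewrite !pm_addE addrA. Qed.
Lemma pm_addC : commutative pm_add.
Proof. by move=> f g; apply: pmap_eq; rewrite !pm_addE addrC. Qed.
Lemma pm_add0 : left_id pm_zero pm_add.
Proof. by move=> f; apply: pmap_eq; rewrite pm_addE add0r. Qed.
Lemma pm_addN : left_inverse pm_zero pm_opp pm_add.
Proof. by move=> f; apply: pmap_eq; rewrite pm_addE pm_oppE addNr. Qed.

HB.instance Definition _ :=
  GRing.isZmodule.Build (pmap X Y) pm_addA pm_addC pm_add0 pm_addN.

Lemma pm_scaleA c d f : pm_scale c (pm_scale d f) = pm_scale (c * d) f.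
Proof. by apply: pmap_eq; rewrite !pm_scaleE scalerA. Qed.
Lemma pm_scale1 : left_id 1 pm_scale.
Proof. by move=> f; apply: pmap_eq; rewrite pm_scaleE scale1r. Qed.
Lemma pm_scaleDr : right_distributive pm_scale +%R.
Proof.
move=> c f g; apply: pmap_eq; rewrite pm_scaleE.
by rewrite -[_ + _ in LHS]/(pm_add f g) -[_ + _ in RHS]/(pm_add _ _) !pm_addE
  !pm_scaleE scalerDr.
Qed.
Lemma pm_scaleDl f : {morph pm_scale^~ f : c d / c + d}.
Proof.
move=> c d; apply: pmap_eq; rewrite pm_scaleE.
by rewrite -[_ + _ in RHS]/(pm_add _ _) pm_addE !pm_scaleE scalerDl.
Qed.

HB.instance Definition _ := GRing.Zmodule_isLmodule.Build k (pmap X Y)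
  pm_scaleA pm_scale1 pm_scaleDr pm_scaleDl.

Lemma pmD f g : pm (f + g) = pm f + pm g.
Proof. exact: pm_addE. Qed.
Lemma pmZ c f : pm (c *: f) = c *: pm f.
Proof. exact: pm_scaleE. Qed.

End Ops.

Definition pm_id (X : pcomplex) : pmap X X.
Proof.
by exists (cm_id X) => i j ij; apply: Arrow_idm; exact: pc_obj.
Defined.

Definition pm_comp (X Y Z : pcomplex) (g : pmap Y Z) (f : pmap X Y) : pmap X Z.
Proof.
by exists (cm_comp g f) => i j ij; apply: Arrow_comp; exact: pm_per.
Defined.

Definition periodic_complexes : kcat k.
Proof.
refine (@KCat k pcomplex (fun X Y => pmap X Y : lmodType k) pm_id pm_comp
  _ _ _ _ _).
- by move=> X Y f; apply: pmap_eq; exact: (@mcomp1m _ (complexes A)).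
- by move=> X Y f; apply: pmap_eq; exact: (@mcompm1 _ (complexes A)).
- by move=> X Y Z T h g f; apply: pmap_eq; exact: (@mcompA _ (complexes A)).
- move=> X Y Z g c f f'; apply: pmap_eq.
  change (cm_comp g (pm (c *: f + f')) =
          pm (c *: pm_comp g f + pm_comp g f')).
  rewrite 2!pmD 2!pmZ; exact: (@mcomp_linr _ (complexes A) X Y Z (pm g)).
- move=> X Y Z f c g g'; apply: pmap_eq.
  change (cm_comp (pm (c *: g + g')) f =
          pm (c *: pm_comp g f + pm_comp g' f)).
  rewrite 2!pmD 2!pmZ; exact: (@mcomp_linl _ (complexes A) X Y Z (pm f)).
Defined.

End Periodic.

Section DirectSums.
Variables (k : comPzRingType) (A : kcat k).

Lemma prj_ext (I : eqType) (P : pred I) (X : I -> A) (S T : A)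
    (d : dirsum P X S) (f g : hom T S) :
  (forall i, P i -> ds_prj d i \oc f = ds_prj d i \oc g) -> f = g.
Proof.
move=> fg; rewrite -(mcomp1m f) -(mcomp1m g) -(ds_sum d) !mcomp_suml.
apply: eq_big_seq => i /(ds_suppP) Pi.
by rewrite -!mcompA fg.
Qed.

Lemma ds_zero (I : eqType) (P : pred I) (X : I -> A) (S : A)
    (d : dirsum P X S) (i : I) : P i -> i \notin ds_supp d -> is_zero (X i).
Proof.
move=> Pi si; rewrite /is_zero -(ds_prj_inj d Pi) -[ds_inj d i]mcomp1m -(ds_sum d).
rewrite mcomp_suml mcomp_sumr big_seq big1// => j sj.
rewrite -mcompA ds_prj_inj0 ?mcomp0r//; first exact: (ds_suppP sj).
by apply: contraNneq si => ->.
Qed.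

Lemma prj_diag (I J : eqType) (p : I -> J) (P : pred I) (Q : pred J)
    (X : I -> A) (Y : J -> A) (S T : A) (d : dirsum P X S) (e : dirsum Q Y T)
    (h : forall i, hom (X i) (Y (p i))) (i : I) :
  injective p -> (forall i, P i -> Q (p i)) -> P i ->
  ds_prj e (p i) \oc
    (\sum_(j <- ds_supp d) ds_inj e (p j) \oc h j \oc ds_prj d j) =
  h i \oc ds_prj d i.
Proof.
move=> pI PQ Pi; rewrite mcomp_sumr.
have z j : j != i -> j \in ds_supp d ->
    ds_prj e (p i) \oc (ds_inj e (p j) \oc h j \oc ds_prj d j) = 0.
  move=> ji /(ds_suppP) Pj; rewrite !mcompA ds_prj_inj0 ?mcomp0l//.
  - exact: PQ.
  - exact: PQ.
  - by rewrite (inj_eq pI).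
have [si|si] := boolP (i \in ds_supp d).
  rewrite (bigD1_seq i) ?ds_supp_uniq//= big_seq_cond big1 ?addr0.
    by rewrite !mcompA ds_prj_inj ?mcomp1m//; exact: PQ.
  by move=> j /andP[sj ji]; exact: z.
rewrite [ds_prj d i](is_zero_tgt _ (ds_zero Pi si)) mcomp0r big_seq big1// => j sj.
by apply: z => //; apply: contraNneq si => <-.
Qed.

Variables (Aadd : is_additive A).

Lemma dirsum_exists (P : pred int) (X : int -> A) :
  (exists a b : int, forall i : int, i < a \/ b < i -> is_zero (X i)) ->
  inhabited {S : A & dirsum P X S}.
Proof.
move=> [a [b X0]].
pose s := [seq i <- [seq a + Posz n | n <- iota 0 `|b - a|%N.+1] | P i].
have us : uniq s.
  apply: filter_uniq; rewrite map_inj_uniq ?iota_uniq//.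
  by move=> x y /addrI [].
have sP i : P i -> i \notin s -> is_zero (X i).
  move=> Pi; rewrite mem_filter Pi andTb => /negP si; apply: X0.
  have [ia|ai] := ltP i a; first by left.
  have [bi|ib] := ltP b i; first by right.
  case: si; apply/mapP.
  exists `|i - a|%N; first by rewrite mem_iota; lia.
  lia.
pose Y (n : 'I_(size s)) := X (nth 0 s n).
have [S [d]] := Aadd Y.
pose e i j : hom (X i) (X j) :=
  if i =P j is ReflectT ij then
    match ij in _ = l return hom (X i) (X l) with erefl => idm (X i) end
  else 0.
have ee i : e i i = idm (X i).
  by rewrite /e; case: eqP => // ij; rewrite (Prop_irrelevance ij erefl).
have en i j : i != j -> e i j = 0 by rewrite /e; case: eqP.
constructor; exists S.
pose inj i : hom (X i) S := \sum_(n < size s) ds_inj d n \oc e i (nth 0 s n).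
pose prj i : hom S (X i) := \sum_(n < size s) e (nth 0 s n) i \oc ds_prj d n.
have nth_neq (n l : 'I_(size s)) : l != n -> nth 0 s l != nth 0 s n.
  by move=> ln; rewrite nth_uniq.
have inj_nth (n : 'I_(size s)) : inj (nth 0 s n) = ds_inj d n.
  rewrite /inj (bigD1 n)//= ee mcompm1 big1 ?addr0// => l ln.
  by rewrite en ?mcomp0r// eq_sym nth_neq.
have prj_nth (n : 'I_(size s)) : prj (nth 0 s n) = ds_prj d n.
  rewrite /prj (bigD1 n)//= ee mcomp1m big1 ?addr0// => l ln.
  by rewrite en ?mcomp0l// nth_neq.
have memP i : P i -> (exists n : 'I_(size s), i = nth 0 s n) \/ is_zero (X i).
  move=> Pi; have [si|/(sP i Pi)] := boolP (i \in s); last by right.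
  have hi : (index i s < size s)%N by rewrite index_mem.
  by left; exists (Ordinal hi); rewrite /= nth_index.
apply: (@DirSum _ _ _ P X S inj prj s us).
- by move=> i; rewrite mem_filter => /andP[].
- move=> i /memP[[n ->]|Xi0]; last by rewrite Xi0; exact: is_zero_tgt.
  by rewrite inj_nth prj_nth ds_prj_inj.
- move=> i j /memP[[n ->]|Xi0]; last by move=> _ _; exact: is_zero_src.
  move=> /memP[[l ->]|Xj0]; last by move=> _; exact: is_zero_tgt.
  move=> nl; rewrite inj_nth prj_nth ds_prj_inj0//.
  by apply: contraNneq nl => ->.
- rewrite (big_nth 0) big_mkord.
  apply: (prj_ext (d := d)) => n _; rewrite mcompm1 mcomp_sumr (bigD1 n)//=.
  rewrite inj_nth prj_nth mcompA ds_prj_inj// mcomp1m big1 ?addr0// => l ln.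
  by rewrite inj_nth prj_nth mcompA ds_prj_inj0 ?mcomp0l.
Qed.


Definition bigsum (P : pred int) (X : bounded_complexes A) :
    {S : A & dirsum P (sval X) S} :=
  inhabited_witness (dirsum_exists P (svalP X)).

End DirectSums.

Section Compression.
Variables (k : comPzRingType) (A : kcat k) (Aadd : is_additive A) (m : nat).

(* The residue class {i + tm | t in Z}. *)
Definition residue (i : int) : pred int := fun j => (j == i %[mod m])%Z.

Lemma residueS (i j : int) : residue i j = residue (i + 1) (j + 1).
Proof.
by rewrite /residue; apply/eqP/eqP => [ij|/eqP]; [rewrite -modzDml ij modzDml|
  rewrite eqz_modDr => /eqP].
Qed.

Lemma residue_eq (i j : int) : (i = j %[mod m])%Z -> residue i = residue j.
Proof.
by move=> ij; apply: functional_extensionality_dep => l; rewrite /residue ij.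
Qed.

Section Object.
Variable X : bounded_complexes A.

Definition compr_sum (P : pred int) : A := projT1 (bigsum Aadd P X).

Definition compr_ds (P : pred int) : dirsum P (sval X) (compr_sum P) :=
  projT2 (bigsum Aadd P X).

Definition compr_diff (P Q : pred int) : hom (compr_sum P) (compr_sum Q) :=
  \sum_(j <- ds_supp (compr_ds P))
    ds_inj (compr_ds Q) (j + 1) \oc cd (sval X) j (j + 1) \oc ds_prj (compr_ds P) j.

Definition compr_d (i j : int) :
    hom (compr_sum (residue i)) (compr_sum (residue j)) :=
  if j == i + 1 then compr_diff (residue i) (residue j) else 0.

End Object.

Definition compr_map (X Y : bounded_complexes A) (f : hom X Y) (P : pred int) :
    hom (compr_sum X P) (compr_sum Y P) :=
  \sum_(j <- ds_supp (compr_ds X P))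
    ds_inj (compr_ds Y P) j \oc (f : chain_map (sval X) (sval Y)) j
      \oc ds_prj (compr_ds X P) j.

Lemma compr_diffE X (i j : int) : residue i j ->
  ds_prj (compr_ds X (residue (i + 1))) (j + 1)
    \oc compr_diff X (residue i) (residue (i + 1)) =
  cd (sval X) j (j + 1) \oc ds_prj (compr_ds X (residue i)) j.
Proof.
move=> ij; apply: (prj_diag (p := fun j : int => j + 1)) => //.
- exact: addIr.
- by move=> l; rewrite residueS.
Qed.

Lemma compr_mapE X Y (f : hom X Y) (P : pred int) (j : int) : P j ->
  ds_prj (compr_ds Y P) j \oc compr_map f P =
  (f : chain_map (sval X) (sval Y)) j \oc ds_prj (compr_ds X P) j.
Proof. by move=> Pj; apply: (prj_diag (p := id)). Qed.

Lemma compr_ext X (i : int) (T : A)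
    (f g : hom T (compr_sum X (residue (i + 1)))) :
  (forall j, residue i j -> ds_prj (compr_ds X (residue (i + 1))) (j + 1) \oc f =
                            ds_prj (compr_ds X (residue (i + 1))) (j + 1) \oc g) ->
  f = g.
Proof.
move=> fg; apply: (prj_ext (d := compr_ds X (residue (i + 1)))) => j.
by rewrite -[j](subrK 1) -residueS => /fg.
Qed.

Definition compr_complex (X : bounded_complexes A) : complex A.
Proof.
exists (fun i => compr_sum X (residue i)) (compr_d X).
- by move=> i j ji; rewrite /compr_d (negbTE ji).
- move=> i j l; rewrite /compr_d.
  case: eqP => [->|_]; last by rewrite mcomp0l.
  case: eqP => [->|_]; last by rewrite mcomp0r.
  apply: compr_ext => j' ij'; rewrite mcomp0r.
  move: ij'; rewrite -[j'](subrK 1) -residueS => ij'.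
  rewrite mcompA compr_diffE -?residueS//.
  by rewrite -mcompA compr_diffE// mcompA cd_sq mcomp0l.
Defined.

Definition compr_pcomplex (X : bounded_complexes A) : pcomplex A m.
Proof.
exists (compr_complex X) => i j ij /=; rewrite /compr_d !eqxx.
by rewrite (residue_eq ij) (@residue_eq (i + 1) (j + 1))// -modzDml ij modzDml.
Defined.

Definition compr_chain_map X Y (f : hom X Y) :
  chain_map (compr_complex X) (compr_complex Y).
Proof.
exists (fun i => compr_map f (residue i)) => i j /=; rewrite /compr_d.
case: eqP => [->|_]; last by rewrite mcomp0l mcomp0r.
apply: compr_ext => l il.
rewrite !mcompA compr_mapE -?residueS// compr_diffE//.
by rewrite -!mcompA compr_diffE// compr_mapE// !mcompA cmap_comm.
Defined.

Definition compr_pmap X Y (f : hom X Y) :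
  pmap (compr_pcomplex X) (compr_pcomplex Y).
Proof.
by exists (compr_chain_map f) => i j ij /=; rewrite (residue_eq ij).
Defined.

Definition compression : kfunctor (bounded_complexes A) (periodic_complexes A m).
Proof.
refine (@KFunctor k (bounded_complexes A) (periodic_complexes A m)
  compr_pcomplex compr_pmap _ _ _).
- move=> X; apply: pmap_eq; apply: chain_map_eq => i /=.
  apply: (prj_ext (d := compr_ds X (residue i))) => j ij.
  by rewrite compr_mapE// mcompm1 mcomp1m.
- move=> X Y Z g f; apply: pmap_eq; apply: chain_map_eq => i /=.
  apply: (prj_ext (d := compr_ds Z (residue i))) => j ij.
  by rewrite compr_mapE// mcompA compr_mapE// -mcompA compr_mapE// mcompA.
- move=> X Y c f g; apply: pmap_eq; rewrite pmD pmZ; apply: chain_map_eq => i.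
  apply: (prj_ext (d := compr_ds Y (residue i))) => j ij /=.
  rewrite mcompDr mcompZr !compr_mapE//= -mcompZl -mcompDl.
  by [].
Defined.

End Compression.

(* Main.v *)
From mathcomp Require Import all_boot all_order all_algebra.
From mathcomp Require Import zify.
From mathcomp Require Import boolp classical_sets cardinality fsbigop.
Require Import Defs.

(** Fix an additive, Hom-finite Krull-Schmidt category A, and write F for the
    compression.  Idempotents of A split ([krull_schmidt_split]), and a large power of
    an endomorphism in A has a unique Fitting idempotent ([fitting_idem]).  Both facts
    are natural, so they extend degree by degree to bounded and to periodic complexes
    ([bounded_split], [periodic_split], [bounded_fitting], [periodic_fitting]).  Hence
    every endomorphism of an indecomposable object of either category is invertible or
    nilpotent, and a sum of nonisomorphisms is a nonisomorphism there
    ([noniso_sum]).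

    When periodicity is forgotten, F X is the direct sum of all shifts X[gm], and only
    finitely many of them meet a given bounded range of degrees.  So a map between
    compressions is a matrix of maps between shifts, and it is determined by one row,
    or by one column, because it is periodic: this is the precovering property
    ([compression_precovering]).  The shift changes the sign of the differential and the
    compression does not; the stabilizer therefore carries the signs [shift_corr], which
    form a coboundary.  The action is free since a nonzero bounded complex has a
    bounded support that no nontrivial translation preserves ([shift_free]).

    The hypothesis on indecomposable complexes enters through [bounded_summand].  A
    nonzero complex Z is truncated to a wide interval around a degree c with Z^c
    nonzero; an indecomposable summand W of this truncation with W^c nonzero has
    width at most n, so it does not touch the ends of the interval and is a summand of Z
    itself.

    Let X be indecomposable.  The shifts X[gm] are pairwise nonisomorphic, so an
    endomorphism of F X is controlled modulo nonisomorphisms by its component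
    X -> X, its [corner], and corners multiply as elements of a local ring
    ([corner_mul]).  If Z is a nonzero summand of F X with idempotent e, the identity
    of a bounded summand W of Z factors through e, which is impossible unless the corner
    of e is invertible ([corner_retract]).  Two complementary summands would thus have
    orthogonal idempotents with invertible corners; so F X is indecomposable
    ([compression_indec]).  If F X and F Y are isomorphic, the identity of X is a sum of
    maps through the shifts of Y, one of which must be invertible
    ([compression_orbit]).  Finally, for Z indecomposable and periodic, a bounded summand
    W of Z gives by adjunction maps F W -> Z -> F W whose composition has corner 1; it is
    not nilpotent, so it is invertible, and Z is isomorphic to F W
    ([compression_dense]). *)

Set Implicit Arguments.
Unset Strict Implicit.
Unset Printing Implicit Defensive.
Import Order.TTheory GRing.Theory Num.Theory.
Local Open Scope ring_scope.

(** * Isomorphisms, idempotents and local endomorphism rings *)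

Section Isos.
Variables (k : comPzRingType) (C : kcat k).
Implicit Types X Y Z : C.

Lemma is_iso_idm X : is_iso (idm X).
Proof. by exists (idm X); rewrite mcomp1m. Qed.

Lemma is_iso_comp X Y Z (g : hom Y Z) (f : hom X Y) :
  is_iso g -> is_iso f -> is_iso (g \oc f).
Proof.
move=> [g' [gl gr]] [f' [fl fr]]; exists (f' \oc g'); split.
  by rewrite -mcompA (mcompA g') gl mcomp1m fl.
by rewrite -mcompA (mcompA f) fr mcomp1m gr.
Qed.

Lemma is_iso_opp X Y (f : hom X Y) : is_iso f -> is_iso (- f).
Proof.
by move=> [g [l r]]; exists (- g); rewrite !mcompNl !mcompNr !opprK.
Qed.

Lemma is_iso_lr X Y Z T (f : hom X Y) (g : hom Y Z) (h : hom T X) :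
  is_iso (g \oc f) -> is_iso (f \oc h) -> is_iso f.
Proof.
move=> [u [ul ur]] [v [vl vr]]; rewrite mcompA in ul; rewrite -mcompA in vr.
have e : u \oc g = h \oc v by rewrite -[LHS]mcompm1 -vr mcompA ul mcomp1m.
by exists (u \oc g); split => //; rewrite e.
Qed.

Lemma is_iso_compl X Y Z (g : hom Y Z) (f : hom X Y) :
  is_iso f -> is_iso (g \oc f) -> is_iso g.
Proof.
move=> [f' [fl fr]] /is_iso_comp h.
have /h : is_iso f' by exists f.
by rewrite -mcompA fr mcompm1.
Qed.

Lemma is_iso_compr X Y Z (g : hom Y Z) (f : hom X Y) :
  is_iso g -> is_iso (g \oc f) -> is_iso f.
Proof.
move=> [g' [gl gr]] h.
have /is_iso_comp/(_ h) : is_iso g' by exists g.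
by rewrite mcompA gl mcomp1m.
Qed.

Lemma isom_sym X Y : isom X Y -> isom Y X.
Proof. by move=> [f [g [l r]]]; exists g, f. Qed.

Lemma is_zero_retract X Y (p : hom X Y) (q : hom Y X) :
  q \oc p = idm X -> is_zero Y -> is_zero X.
Proof. by move=> qp /is_zero_tgt Y0; rewrite /is_zero -qp (Y0 _ p) mcomp0r. Qed.

Lemma is_zero_iso0 X : is_iso (0 : hom X X) -> is_zero X.
Proof. by move=> [g [l _]]; rewrite /is_zero -l mcomp0r. Qed.

Definition mpow X (f : hom X X) n := iter n (mcomp f) (idm X).

Lemma mpowD X (f : hom X X) a b : mpow f (a + b) = mpow f a \oc mpow f b.
Proof. by elim: a => [|a IH]; rewrite ?mcomp1m// addSn /= IH mcompA. Qed.

Lemma mpowSr X (f : hom X X) a : mpow f a.+1 = mpow f a \oc f.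
Proof. by rewrite -addn1 mpowD /= mcompm1. Qed.

Lemma is_iso_mpow X (f : hom X X) a : is_iso (mpow f a.+1) -> is_iso f.
Proof.
by move=> h; apply: (is_iso_lr (g := mpow f a) (h := mpow f a)); rewrite -?mpowSr.
Qed.

(** The inverse is the geometric sum. *)
Lemma is_iso_1B X (f : hom X X) a : mpow f a = 0 -> is_iso (idm X - f).
Proof.
move=> fa.
have geoml : (idm X - f) \oc (\sum_(i < a) mpow f i) = idm X.
  rewrite mcompDl mcomp1m mcompNl mcomp_sumr -sumrB.
  have -> : \sum_(i < a) (mpow f i - f \oc mpow f i) = idm X - mpow f a.
    elim: {fa} a => [|a IH]; first by rewrite big_ord0 subrr.
    by rewrite big_ord_recr /= IH addrA subrK.
  by rewrite fa subr0.
have geomr : (\sum_(i < a) mpow f i) \oc (idm X - f) = idm X.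
  rewrite -{}[RHS]geoml mcomp_suml mcomp_sumr; apply: eq_bigr => i _.
  by rewrite mcompDr mcompDl mcompNr mcompNl -mpowSr mcompm1 mcomp1m.
by exists (\sum_(i < a) mpow f i).
Qed.

Lemma ds_sum_fin (I : finType) (Y : I -> C) X (d : dirsum predT Y X) :
  \sum_i ds_inj d i \oc ds_prj d i = idm X.
Proof.
apply: (prj_ext (d := d)) => i _; rewrite mcompm1 mcomp_sumr (bigD1 i)//=.
rewrite mcompA ds_prj_inj// mcomp1m big1 ?addr0// => j ji.
by rewrite mcompA ds_prj_inj0// mcomp0l.
Qed.

Lemma inj_ext (I : eqType) (P : pred I) (X : I -> C) S T
    (d : dirsum P X S) (f g : hom S T) :
  (forall i, P i -> f \oc ds_inj d i = g \oc ds_inj d i) -> f = g.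
Proof.
move=> fg; rewrite -(mcompm1 f) -(mcompm1 g) -(ds_sum d) !mcomp_sumr.
by apply: eq_big_seq => i /(ds_suppP) Pi; rewrite !mcompA fg.
Qed.

(** Orthogonality follows from the sum formula: multiplied by b0 on the left and
    a1 on the right, it says that b0 a1 = b0 a1 + b0 a1. *)
Lemma split_dirsum X Y0 Y1 (a0 : hom Y0 X) (b0 : hom X Y0)
    (a1 : hom Y1 X) (b1 : hom X Y1) :
  b0 \oc a0 = idm Y0 -> b1 \oc a1 = idm Y1 ->
  a0 \oc b0 + a1 \oc b1 = idm X ->
  is_dirsum (fun b : bool => if b then Y1 else Y0) X.
Proof.
move=> ba0 ba1 s.
have z0 : b0 \oc a1 = 0.
  apply: (addrI (b0 \oc a1)).
  rewrite addr0 -{3}(mcomp1m a1) -s mcompDl mcompDr -!mcompA ba1 mcompm1.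
  by rewrite (mcompA b0 a0) ba0 mcomp1m.
have z1 : b1 \oc a0 = 0.
  apply: (addrI (b1 \oc a0)).
  rewrite addr0 -{3}(mcomp1m a0) -s mcompDl mcompDr -!mcompA ba0 mcompm1.
  by rewrite (mcompA b1 a1) ba1 mcomp1m.
constructor.
exists (fun b : bool => if b return hom (if b then Y1 else Y0) X then a1 else a0)
       (fun b : bool => if b return hom X (if b then Y1 else Y0) then b1 else b0)
       [:: false; true] => //.
- by case.
- by case; case.
- by rewrite !big_cons big_nil addr0.
Qed.

Definition idem_split := forall X (e : hom X X), e \oc e = e ->
  exists Y (a : hom Y X) (b : hom X Y), b \oc a = idm Y /\ a \oc b = e.

Lemma idem_compl X (e : hom X X) : e \oc e = e ->
  (idm X - e) \oc (idm X - e) = idm X - e.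
Proof.
by move=> ee; rewrite mcompDl mcomp1m mcompNl mcompDr mcompm1 mcompNr ee subrr subr0.
Qed.

Hypothesis Csplit : idem_split.

(** Both e and 1 - e split, and one of the two images is zero. *)
Lemma idem_indec X (e : hom X X) : indecomposable X -> e \oc e = e ->
  e = 0 \/ e = idm X.
Proof.
move=> [_ Xind] ee.
have [Y0 [a0 [b0 [ba0 ab0]]]] := Csplit ee.
have [Y1 [a1 [b1 [ba1 ab1]]]] := Csplit (idem_compl ee).
case: (Xind _ (split_dirsum ba0 ba1 _)) => [|z|z]; first by rewrite ab0 ab1 addrC subrK.
- right; apply/esym/eqP; rewrite -subr_eq0 -ab1.
  by rewrite [a1](is_zero_src _ z) mcomp0l.
- by left; rewrite -ab0 [a0](is_zero_src _ z) mcomp0l.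
Qed.

(** If u is the inverse of q p, then p u q is an idempotent of X; it is not 0,
    hence it is 1. *)
Lemma retract_indec X W (p : hom W X) (q : hom X W) :
  indecomposable X -> ~ is_zero W -> is_iso (q \oc p) -> is_iso p /\ is_iso q.
Proof.
move=> Xind W0 [u [ul ur]].
have ee : (p \oc u \oc q) \oc (p \oc u \oc q) = p \oc u \oc q.
  by rewrite -!mcompA (mcompA q p) (mcompA (q \oc p) u) ur mcomp1m.
case: (idem_indec Xind ee) => e.
  case: W0; rewrite /is_zero -ul -[q \oc p]mcomp1m -ur -!mcompA (mcompA u q p).
  by rewrite (mcompA p (u \oc q)) (mcompA p u) e mcomp0l !mcomp0r.
split; first by exists (u \oc q); rewrite -mcompA ul mcompA e.
by exists (p \oc u); rewrite mcompA ur e.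
Qed.

(** The conclusion of Fitting's lemma; it makes the endomorphism ring of an
    indecomposable object local. *)
Definition fitting := forall X (f : hom X X), indecomposable X ->
  is_iso f \/ exists a, mpow f a = 0.

Hypothesis Cfit : fitting.

(** If u is the inverse of f + g, then u f is nilpotent, so that u g = 1 - u f is
    invertible. *)
Lemma noniso_add X (f g : hom X X) : indecomposable X ->
  ~ is_iso f -> ~ is_iso g -> ~ is_iso (f + g).
Proof.
move=> Xind nf ng [u [ul ur]]; apply: ng.
have uiso : is_iso u by exists (f + g).
case: (Cfit (u \oc f) Xind) => [/(is_iso_compr uiso)//|[a /is_iso_1B]].
by rewrite -ul mcompDr addrC addKr => /(is_iso_compr uiso).
Qed.

Lemma noniso_sum X (J : eqType) (r : seq J) (f : J -> hom X X) :
  indecomposable X -> (forall j, j \in r -> ~ is_iso (f j)) ->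
  ~ is_iso (\sum_(j <- r) f j).
Proof.
move=> Xind; elim: r => [|j r IH] nf.
  by rewrite big_nil => /is_zero_iso0; case: Xind.
rewrite big_cons; apply: noniso_add => //; first by apply: nf; rewrite mem_head.
by apply: IH => i ir; apply: nf; rewrite in_cons ir orbT.
Qed.

(** If q f p were invertible, then p would be the inclusion of a nonzero retract of X
    and q the projection onto one of Y, hence both would be isomorphisms. *)
Lemma noniso_through X Y W (f : hom X Y) (p : hom W X) (q : hom Y W) :
  indecomposable X -> indecomposable Y -> indecomposable W ->
  ~ is_iso f -> ~ is_iso (q \oc f \oc p).
Proof.
move=> Xind Yind [W0 _] nf h; apply: nf.
have [piso _] := retract_indec Xind W0 h.
rewrite -mcompA in h; have [_ qiso] := retract_indec Yind W0 h.
exact: is_iso_compl piso (is_iso_compr qiso h).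
Qed.

End Isos.

(** * Splitting of idempotents in a Krull-Schmidt category *)

Section Splitting.
Variables (k : comPzRingType) (A : kcat k).
Implicit Types X Y Z : A.

Definition splits X := forall e : hom X X, e \oc e = e ->
  exists Y (a : hom Y X) (b : hom X Y), b \oc a = idm Y /\ a \oc b = e.

(** If e is invertible on the summand X1, then a = e i1 embeds X1 into X with
    retraction b, and X', moved along X1 into the kernel of b, is a complement. *)
Lemma exchange X X1 X' (i1 : hom X1 X) (p1 : hom X X1) (i' : hom X' X)
    (p' : hom X X') (e : hom X X) :
  p' \oc i' = idm X' -> p1 \oc i' = 0 ->
  i1 \oc p1 + i' \oc p' = idm X ->
  e \oc e = e -> is_iso (p1 \oc e \oc i1) ->
  exists (a : hom X1 X) (b : hom X X1) (c : hom X' X) (d : hom X X'),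
    [/\ b \oc a = idm X1, d \oc c = idm X', a \oc b + c \oc d = idm X,
        e \oc a = a & b \oc e = b].
Proof.
move=> pi' p1i' sum1 ee [w [wu uw]].
pose a := e \oc i1; pose b := w \oc p1 \oc e.
have wp1a : w \oc p1 \oc a = idm X1 by rewrite /a -wu !mcompA.
have p1aw : p1 \oc a \oc w = idm X1 by rewrite /a mcompA.
have ea : e \oc a = a by rewrite /a mcompA ee.
have be : b \oc e = b by rewrite /b -mcompA ee.
have ba : b \oc a = idm X1 by rewrite /b -mcompA ea.
have kill_a : (idm X - a \oc b) \oc a = 0.
  by rewrite mcompDl mcompNl mcomp1m -mcompA ba mcompm1 subrr.
have kill_a' : (idm X - a \oc w \oc p1) \oc a = 0.
  by rewrite mcompDl mcompNl mcomp1m -(mcompA a) -(mcompA a) wp1a mcompm1 subrr.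
exists a, b, ((idm X - a \oc b) \oc i'), (p' \oc (idm X - a \oc w \oc p1)).
split=> //.
- rewrite -mcompA (mcompA _ (idm X - _) i').
  have -> : (idm X - a \oc w \oc p1) \oc (idm X - a \oc b) = idm X - a \oc w \oc p1.
    by rewrite (mcompDr _ (idm X)) mcompm1 mcompNr mcompA kill_a' mcomp0l subr0.
  by rewrite mcompDl mcompNl mcomp1m -[_ \oc p1 \oc _]mcompA p1i' mcomp0r subr0.
- rewrite -mcompA (mcompA i').
  have -> : i' \oc p' = idm X - i1 \oc p1 by rewrite -sum1 addrC addKr.
  have -> : (idm X - i1 \oc p1) \oc (idm X - a \oc w \oc p1) =
            idm X - a \oc w \oc p1.
    rewrite mcompDl mcomp1m mcompNl mcompDr mcompm1 mcompNr -(mcompA i1).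
    by rewrite (mcompA p1 (a \oc w)) (mcompA p1 a) p1aw mcomp1m subrr subr0.
  rewrite (mcompDr _ (idm X)) mcompm1 mcompNr -(mcompA a w) (mcompA _ a).
  rewrite kill_a mcomp0l subr0.
  by rewrite addrC subrK.
Qed.

Hypothesis Aadd : is_additive A.

Lemma sum2 X Y : exists S (s1 : hom X S) (s2 : hom Y S) (t1 : hom S X) (t2 : hom S Y),
  [/\ t1 \oc s1 = idm X, t2 \oc s2 = idm Y, t1 \oc s2 = 0, t2 \oc s1 = 0 &
      s1 \oc t1 + s2 \oc t2 = idm S].
Proof.
have [S [d]] := Aadd (fun i : 'I_2 => if val i == 0%N then X else Y).
exists S, (ds_inj d ord0), (ds_inj d (lift ord0 ord0)),
  (ds_prj d ord0), (ds_prj d (lift ord0 ord0)); split.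
- exact: (ds_prj_inj d (i := ord0)).
- exact: (ds_prj_inj d (i := lift ord0 ord0)).
- exact: (ds_prj_inj0 d (i := lift ord0 ord0) (j := ord0)).
- exact: (ds_prj_inj0 d (i := ord0) (j := lift ord0 ord0)).
- by have := ds_sum_fin d; rewrite big_ord_recl big_ord1.
Qed.

(** If e is invertible on X1, its image contains a copy of X1, and what remains of e is
    an idempotent of X'.  Otherwise 1 - e is invertible on X1, and e itself is
    an idempotent of X'. *)
Lemma splits_step X X1 X' (i1 : hom X1 X) (p1 : hom X X1) (i' : hom X' X)
    (p' : hom X X') :
  local_end X1 -> p1 \oc i1 = idm X1 -> p' \oc i' = idm X' -> p1 \oc i' = 0 ->
  i1 \oc p1 + i' \oc p' = idm X ->
  splits X' -> splits X.
Proof.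
move=> [_ loc] p1i1 pi' p1i' sum1 spl' e ee.
have cross (a : hom X1 X) (b : hom X X1) (c : hom X' X) (d : hom X X') :
    b \oc a = idm X1 -> d \oc c = idm X' -> a \oc b + c \oc d = idm X ->
    [/\ c \oc d = idm X - a \oc b, b \oc c = 0 & d \oc a = 0].
  move=> ba dc sum.
  have cd : c \oc d = idm X - a \oc b by rewrite -sum addrC addKr.
  split=> //.
    rewrite -[c]mcompm1 -dc (mcompA c) cd mcompA mcompDr mcompm1 mcompNr mcompA ba.
    by rewrite mcomp1m subrr mcomp0l.
  rewrite -[d]mcomp1m -dc -[_ \oc c \oc d]mcompA cd -mcompA mcompDl mcomp1m mcompNl.
  by rewrite -(mcompA a) ba mcompm1 subrr mcomp0r.
case: (loc (p1 \oc e \oc i1)) => u.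
- have [a [b [c [d [ba dc sum ea be]]]]] := exchange pi' p1i' sum1 ee u.
  have [cd bc da] := cross _ _ _ _ ba dc sum.
  have ecd : e \oc (c \oc d) = e - a \oc b.
    by rewrite cd mcompDr mcompm1 mcompNr mcompA ea.
  have [|Y [a' [b' [ba' ab']]]] := spl' (d \oc e \oc c).
    rewrite -!mcompA (mcompA c d) (mcompA e (c \oc d)) ecd mcompDl mcompNl.
    by rewrite -(mcompA a) (mcompA b e) be bc mcomp0r subr0 (mcompA e) ee.
  have [S [s1 [s2 [t1 [t2 [ts1 ts2 ts12 ts21 sumS]]]]]] := sum2 X1 Y.
  exists S, (a \oc t1 + c \oc a' \oc t2), (s1 \oc b + s2 \oc b' \oc d); split.
    rewrite mcompDl !mcompDr -!mcompA !(mcompA b) ba bc !(mcompA d) da dc.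
    rewrite !mcomp1m !mcomp0l !mcomp0r addr0 add0r (mcompA b') ba' mcomp1m.
    exact: sumS.
  rewrite mcompDl !mcompDr -!mcompA !(mcompA t1) !(mcompA t2) ts1 ts2 ts12 ts21.
  rewrite !mcomp0l !mcomp0r !mcomp1m addr0 add0r (mcompA a') ab'.
  rewrite -!mcompA ecd mcompA cd mcompDl mcomp1m mcompNl -mcompA (mcompDr b) be.
  by rewrite mcompNr (mcompA b a) ba mcomp1m subrr mcomp0r subr0 addrC subrK.
- have u' : is_iso (p1 \oc (idm X - e) \oc i1).
    by rewrite mcompDr mcompm1 mcompDl mcompNr mcompNl p1i1.
  have [a [b [c [d [ba dc sum ea be]]]]] := exchange pi' p1i' sum1 (idem_compl ee) u'.
  have [cd _ _] := cross _ _ _ _ ba dc sum.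
  have ea0 : e \oc a = 0 by rewrite -ea mcompA mcompDr mcompm1 mcompNr ee subrr mcomp0l.
  have be0 : b \oc e = 0 by rewrite -be -mcompA mcompDl mcomp1m mcompNl ee subrr mcomp0r.
  have ecd : e \oc (c \oc d) = e.
    by rewrite cd mcompDr mcompm1 mcompNr mcompA ea0 mcomp0l subr0.
  have [|Y [a' [b' [ba' ab']]]] := spl' (d \oc e \oc c).
    by rewrite -!mcompA (mcompA c d) (mcompA e (c \oc d)) ecd (mcompA e) ee.
  exists Y, (c \oc a'), (b' \oc d); split.
    by rewrite -mcompA (mcompA d) dc mcomp1m.
  have cde : c \oc d \oc e = e.
    by rewrite cd mcompDl mcomp1m mcompNl -mcompA be0 mcomp0r subr0.
  by rewrite -mcompA (mcompA a') ab' -!mcompA ecd mcompA.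
Qed.

(** By induction on the number of summands with local endomorphism ring, which are
    removed one at a time. *)
Lemma krull_schmidt_split : krull_schmidt A -> idem_split A.
Proof.
move=> ks X; have [n [Y [loc [d]]]] := ks X.
elim: n => [|n IH] in X Y loc d *.
  have X0 : idm X = 0 by rewrite -(ds_sum_fin d) big_ord0.
  move=> e ee; exists X, 0, 0; rewrite mcomp0l X0; split => //.
  by rewrite (is_zero_src e).
have [S [dS]] := Aadd (fun i => Y (lift ord0 i)).
have splS : splits S by apply: (IH _ _ _ dS) => i; exact: loc.
pose i' : hom S X := \sum_i ds_inj d (lift ord0 i) \oc ds_prj dS i.
pose p' : hom X S := \sum_i ds_inj dS i \oc ds_prj d (lift ord0 i).
apply: (@splits_step X (Y ord0) S (ds_inj d ord0) (ds_prj d ord0) i' p' (loc _)) => //.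
- exact: ds_prj_inj.
- apply: (prj_ext (d := dS)) => i _; rewrite mcompm1 /p' mcompA mcomp_sumr (bigD1 i)//=.
  rewrite mcompA ds_prj_inj// mcomp1m big1 ?addr0.
    rewrite /i' mcomp_sumr (bigD1 i)//= mcompA ds_prj_inj// mcomp1m big1 ?addr0//.
    by move=> j ji; rewrite mcompA ds_prj_inj0// ?mcomp0l// (inj_eq lift_inj).
  by move=> j ji; rewrite mcompA ds_prj_inj0// mcomp0l.
- rewrite /i' mcomp_sumr big1// => j _.
  by rewrite mcompA ds_prj_inj0// mcomp0l.
- have := ds_sum_fin d; rewrite big_ord_recl => <-; congr (_ + _).
  rewrite /p' mcomp_sumr; apply: eq_bigr => j _; rewrite mcompA; congr (_ \oc _).
  rewrite /i' mcomp_suml (bigD1 j)//= -mcompA ds_prj_inj// mcompm1 big1 ?addr0//.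
  by move=> l lj; rewrite -mcompA ds_prj_inj0 ?mcomp0r// eq_sym.
Qed.

End Splitting.

(** * Consequences of finite length *)

Section FiniteLength.
Variables (k : comPzRingType).

Lemma descending_stops (V : lmodType k) : finite_length V ->
  exists N, forall D : nat -> {pred V}, (forall i, submod_closed (D i)) ->
    (forall i, {subset D i.+1 <= D i}) ->
    exists2 i, (i <= N)%N & {subset D i <= D i.+1}.
Proof.
move=> [N chainN]; exists N => D Dsub Dle; apply: contrapT => noi.
suff /(chainN N.+1 (fun i => D (N.+1 - i)%N)) : forall i, (i < N.+1)%N ->
    {subset D (N.+1 - i)%N <= D (N.+1 - i.+1)%N} /\
    exists v, v \in D (N.+1 - i.+1)%N /\ v \notin D (N.+1 - i)%N.
  by rewrite ltnn => /(_ (fun _ _ => Dsub _)).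
move=> i iN; rewrite subSS subSn//; split; first exact: Dle.
apply: contrapT => nov; apply: noi; exists (N - i)%N; first exact: leq_subr.
move=> v vD; apply: contrapT => /negP vD'; apply: nov; by exists v.
Qed.

(** The right ideals f^i End S form a descending chain. *)
Lemma fitted_right (A : kcat k) (S : A) : finite_length (hom S S) ->
  exists N, forall f : hom S S, forall M, (N <= M)%N ->
  exists h, mpow f M = mpow f (M + M) \oc h.
Proof.
move=> /descending_stops[N stop]; exists N => f M NM.
pose D i := [pred v : hom S S | `[< exists h, v = mpow f i \oc h >]].
have DP i v : v \in D i <-> exists h, v = mpow f i \oc h.
  by split=> [/asboolP|h]; last exact/asboolP.
have Dsub i : submod_closed (D i).
  split; first by apply/DP; exists 0; rewrite mcomp0r.
  move=> c u v /DP[h ->] /DP[h' ->]; apply/DP.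
  by exists (c *: h + h'); rewrite mcompDr mcompZr.
have Dle i : {subset D i.+1 <= D i}.
  by move=> v /DP[h ->]; apply/DP; exists (f \oc h); rewrite mcompA -mpowSr.
have [i iN /(_ (mpow f i))] := stop D Dsub Dle.
move=> /(_ _)/DP[|h ih]; first by apply/DP; exists (idm S); rewrite mcompm1.
have M1 : mpow f M = mpow f M.+1 \oc h.
  have iM := leq_trans iN NM.
  by rewrite -{1}(subnK iM) mpowD ih mcompA -mpowD addnS subnK.
suff shift_pow j : mpow f M = mpow f (j + M) \oc mpow h j by exists (mpow h M).
elim: j => [|j IH]; first by rewrite mcompm1.
by rewrite {1}IH mpowD {1}M1 addSnnS mpowD /= -!mcompA.
Qed.


(** Exchanges right and left ideals of endomorphism rings. *)
Definition op_cat (A : kcat k) : kcat k.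
Proof.
refine (@KCat k A (fun X Y => @hom k A Y X) (@idm k A)
  (fun X Y Z (g : @hom k A Z Y) (f : @hom k A Y X) => f \oc g) _ _ _ _ _).
- by move=> X Y f; exact: mcompm1.
- by move=> X Y f; exact: mcomp1m.
- by move=> X Y Z T h g f; rewrite mcompA.
- by move=> X Y Z g; exact: mcomp_linl.
- by move=> X Y Z f; exact: mcomp_linr.
Defined.

Lemma mpow_op (A : kcat k) (S : A) (f : hom S S) a :
  @mpow k (op_cat A) S f a = mpow f a.
Proof. by elim: a => // a IH; rewrite [RHS]mpowSr -IH. Qed.

Lemma fitted_left (A : kcat k) (S : A) : finite_length (hom S S) ->
  exists N, forall f : hom S S, forall M, (N <= M)%N ->
  exists h, mpow f M = h \oc mpow f (M + M).
Proof.
move=> fin; have [N fitN] := @fitted_right (op_cat A) S fin; exists N => f M /(fitN f).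
by rewrite !mpow_op.
Qed.

Variable A : kcat k.
Implicit Types S T : A.

(** When g is a large power of an endomorphism, e is the projection onto the image
    of g along its kernel. *)
Definition fitting_idem S (g e : hom S S) := exists h h',
  [/\ e = g \oc h, e = h' \oc g, e \oc g = g & g \oc e = g].

(** From g = g^2 h = h' g^2 it follows that g h = h' g^2 h = h' g. *)
Lemma fitting_idem_exists S : finite_length (hom S S) ->
  exists N, forall f : hom S S, forall M, (N <= M)%N ->
    exists e, fitting_idem (mpow f M) e.
Proof.
move=> fin; have [N1 fitr] := fitted_right fin.
have [N2 fitl] := fitted_left fin.
exists (maxn N1 N2) => f M; rewrite geq_max => /andP[/(fitr f)[h gh] /(fitl f)[h']].
rewrite mpowD => gh'; rewrite mpowD in gh.
set g := mpow f M in gh gh' *.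
have e : g \oc h = h' \oc g by rewrite {1}gh' -!mcompA (mcompA g) -gh.
exists (g \oc h), h, h'; split=> //; last by rewrite mcompA -gh.
by rewrite e -mcompA -gh'.
Qed.

Lemma fitting_idem_idem S (g e : hom S S) : fitting_idem g e -> e \oc e = e.
Proof. by move=> [h [h' [e1 e2 e3 e4]]]; rewrite {1}e2 -mcompA e4. Qed.

(** Although h and h' are not unique, the idempotent is; hence it inherits the
    compatibility of g with the differentials and its periodicity. *)
Lemma fitting_idem_uniq S (g e e' : hom S S) :
  fitting_idem g e -> fitting_idem g e' -> e = e'.
Proof.
move=> [h [_ [e1 _ _ e4]]] [_ [h' [_ e2' e3' _]]].
have : e' \oc e = e by rewrite {1 2}e1 mcompA e3'.
by rewrite {1}e2' -mcompA e4 -e2' => ->.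
Qed.

Lemma fitting_idem_nat S T (d : hom S T) (g e : hom S S) (g' e' : hom T T) :
  fitting_idem g e -> fitting_idem g' e' ->
  d \oc g = g' \oc d -> d \oc e = e' \oc d.
Proof.
move=> [h [_ [e1 _ _ e4]]] [_ [h' [_ e2' e3' _]]] dg.
have <- : e' \oc (d \oc e) = d \oc e.
  by rewrite {1 2}e1 !(mcompA d) dg -!mcompA (mcompA e') e3'.
by rewrite e2' -!mcompA (mcompA g' d) -dg -(mcompA d) e4.
Qed.

Lemma fitting_idem_Arrow S S' (g e : hom S S) (g' e' : hom S' S') :
  fitting_idem g e -> fitting_idem g' e' -> Arrow g = Arrow g' ->
  Arrow e = Arrow e'.
Proof.
move=> ge ge' gg'; have SS' := Arrow_src gg'.
case: _ / SS' g' e' ge' gg' => g' e' ge' /Arrow_inj gg'.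
by rewrite -{}gg' in ge'; rewrite (fitting_idem_uniq ge ge').
Qed.

Lemma fitting_idem0 S (g : hom S S) : fitting_idem g 0 -> g = 0.
Proof. by move=> [h [h' [_ _ <- _]]]; rewrite mcomp0l. Qed.

Lemma fitting_idem1 S (g : hom S S) : fitting_idem g (idm S) -> is_iso g.
Proof.
move=> [h [h' [gh hg _ _]]].
by apply: (is_iso_lr (g := h') (h := h)); rewrite -?gh -?hg; exact: is_iso_idm.
Qed.

Definition strict_chain (V : lmodType k) (r : nat) (M : nat -> {pred V}) : Prop :=
  (forall i, (i <= r)%N -> submod_closed (M i)) /\
  (forall i, (i < r)%N -> {subset M i <= M i.+1} /\
     exists v, v \in M i.+1 /\ v \notin M i).

(** The maximal length of a chain of submodules of End S is a measure that
    drops strictly from an object to its proper retracts. *)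
Lemma retract_measure : hom_finite A ->
  exists len : A -> nat, forall S T (a : hom T S) (b : hom S T),
    b \oc a = idm T ->
    (len T <= len S /\ (a \oc b <> idm S -> len T < len S))%N.
Proof.
move=> Afin; pose chain S := @strict_chain (hom S S).
have len_ex S : exists l, (exists M, chain S l M) /\ forall r M, chain S r M -> (r <= l)%N.
  have [N chainN] := Afin S S.
  have ex0 : exists r, `[< exists M, chain S r M >].
    exists 0%N; apply/asboolP; by exists (fun _ => [pred _ | true] : {pred _}).
  have leN r : `[< exists M, chain S r M >] -> (r <= N)%N.
    by move=> /asboolP[M []]; exact: chainN.
  case: (ex_maxnP ex0 leN) => l /asboolP lM lmax; exists l; split=> // r M rM.
  by apply: lmax; apply/asboolP; exists M.
have [len lenP] := choice len_ex; exists len => S T a b ba.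
have [[M [Msub Mlt]] _] := lenP T; have [_ lmax] := lenP S.
pose emb (v : hom T T) : hom S S := a \oc v \oc b.
have embK v : b \oc emb v \oc a = v.
  by rewrite /emb -!mcompA ba mcompm1 mcompA ba mcomp1m.
pose D i : {pred hom S S} := if (i <= len T)%N then
  [pred w | `[< exists2 v, v \in M i & w = emb v >]] else predT.
have DP i w : (i <= len T)%N -> w \in D i <-> exists2 v, v \in M i & w = emb v.
  by rewrite /D => ->; split=> [/asboolP|h]; last exact/asboolP.
have embD i v : (i <= len T)%N -> (emb v \in D i) = (v \in M i).
  move=> iT; apply/idP/idP => [/(DP _ _ iT)[v' v'M]|vM]; last by apply/(DP _ _ iT); exists v.
  by move=> /(congr1 (fun w => b \oc w \oc a)); rewrite !embK => ->.
have Dsub i : submod_closed (D i).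
  have [iT|Ti] := leqP i (len T); last by rewrite /D leqNgt Ti.
  have [M0 Mlin] := Msub i iT; split.
    by apply/(DP _ _ iT); exists 0 => //; rewrite /emb mcomp0r mcomp0l.
  move=> c u v /(DP _ _ iT)[u' uM ->] /(DP _ _ iT)[v' vM ->]; apply/(DP _ _ iT).
  by exists (c *: u' + v'); [exact: Mlin|rewrite /emb mcompDr mcompDl mcompZr mcompZl].
have Dlt i : (i < len T)%N -> {subset D i <= D i.+1} /\
    exists v, v \in D i.+1 /\ v \notin D i.
  move=> iT; have [sub [v [v1 v2]]] := Mlt i iT; split.
    move=> w /(DP _ _ (ltnW iT))[u uM ->]; rewrite embD//; exact: sub.
  by exists (emb v); rewrite !embD// ltnW.
split; first by apply: (lmax _ D); split=> // i _; exact: Dsub.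
move=> ab1; apply: (lmax _ D); split=> [i _|i]; first exact: Dsub.
rewrite ltnS leq_eqVlt => /predU1P[->|/Dlt//].
split; first by move=> w _; rewrite /D ltnn.
exists (idm S); split; first by rewrite /D ltnn.
apply/negP => /(DP _ _ (leqnn _))[v _ e]; apply: ab1.
by rewrite -[_ \oc _]mcompm1 e /emb -!mcompA (mcompA b) ba mcomp1m.
Qed.

End FiniteLength.

(** * Idempotents and Fitting's lemma for complexes *)

Section ComplexCategories.
Variables (k : comPzRingType) (A : kcat k).
Implicit Types (X Y : complex A).

Lemma cm_sumE X Y (J : Type) (r : seq J) (f : J -> chain_map X Y) i :
  (\sum_(j <- r) f j) i = \sum_(j <- r) f j i.
Proof. by elim: r => [|j r IH]; rewrite ?big_nil// !big_cons -IH. Qed.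

Lemma complex_zeroP X : @is_zero k (complexes A) X <-> forall i, is_zero (X i).
Proof.
split=> [X0 i|X0]; last by apply: chain_map_eq => i; exact: X0.
exact: (congr1 (fun f : chain_map X X => f i) X0).
Qed.

Lemma cm_pow X (f : chain_map X X) n i :
  (@mpow k (complexes A) X f n : chain_map X X) i = mpow (f i) n.
Proof. by elim: n => //= n ->. Qed.

Lemma cm_iso_deg X Y (f : chain_map X Y) i :
  @is_iso k (complexes A) X Y f -> is_iso (f i).
Proof.
move=> [g [gf fg]]; exists ((g : chain_map Y X) i); split.
  exact: (congr1 (fun h : chain_map X X => h i) gf).
exact: (congr1 (fun h : chain_map Y Y => h i) fg).
Qed.

Lemma iso_comm (S S' T T' : A) (d : hom S S') (d' : hom T T')
    (f : hom S T) (f' : hom S' T') (g : hom T S) (g' : hom T' S') :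
  f \oc g = idm T -> g' \oc f' = idm S' -> f' \oc d = d' \oc f ->
  g' \oc d' = d \oc g.
Proof.
move=> fg gf fd.
by rewrite -[d']mcompm1 -fg (mcompA d') -fd !mcompA gf mcomp1m.
Qed.

Lemma cm_iso X Y (f : chain_map X Y) (g : forall i, hom (Y i) (X i)) :
  (forall i, g i \oc f i = idm (X i)) -> (forall i, f i \oc g i = idm (Y i)) ->
  exists g' : chain_map Y X, [/\ forall i, g' i = g i,
    cm_comp g' f = cm_id X & cm_comp f g' = cm_id Y].
Proof.
move=> gf fg.
have gd i j : g j \oc cd Y i j = cd X i j \oc g i.
  exact: iso_comm (fg i) (gf j) (cmap_comm f i j).
by exists (ChainMap gd); split=> //; apply: chain_map_eq.
Qed.

Lemma cm_iso_ex X Y (f : chain_map X Y) : (forall i, is_iso (f i)) ->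
  exists g : chain_map Y X, cm_comp g f = cm_id X /\ cm_comp f g = cm_id Y.
Proof.
move=> /(_ _)/cid fi; pose g i := projT1 (fi i).
have [i|i|h [_ hf fh]] := @cm_iso X Y f g; last by exists h.
- by case: (projT2 (fi i)).
- by case: (projT2 (fi i)).
Qed.

Lemma bounded_iso (X Y : bounded_complexes A) (f : hom X Y) :
  (forall i, is_iso ((f : chain_map (sval X) (sval Y)) i)) -> is_iso f.
Proof. exact: cm_iso_ex. Qed.

Lemma inverse_Arrow (S T S' T' : A) (f : hom S T) (g : hom T S)
    (f' : hom S' T') (g' : hom T' S') :
  g \oc f = idm S -> f' \oc g' = idm T' -> Arrow f = Arrow f' -> Arrow g = Arrow g'.
Proof.
move=> gf fg' /ArrowP[eS [eT e]].
case: _ / eS f' g' e fg' => f' g'; case: _ / eT f' g' => f' g' /= -> fg.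
by rewrite -[g]mcompm1 -fg mcompA gf mcomp1m.
Qed.

Lemma periodic_iso m (X Y : periodic_complexes A m) (f : hom X Y) :
  (forall i, is_iso ((f : pmap X Y) i)) -> is_iso f.
Proof.
move=> /cm_iso_ex[g [gf fg]].
have gper (i j : int) : (i = j %[mod m])%Z -> Arrow (g i) = Arrow (g j).
  move=> ij; apply: (@inverse_Arrow _ _ _ _ ((f : pmap X Y) i) _ ((f : pmap X Y) j)).
  - exact: (congr1 (fun h : chain_map X X => h i) gf).
  - exact: (congr1 (fun h : chain_map Y Y => h j) fg).
  - exact: pm_per.
by exists (PMap gper : pmap Y X); split; apply: pmap_eq.
Qed.

Record splitting (S : A) (e : hom S S) := Splitting {
  sp_obj : A;
  sp_in : hom sp_obj S;
  sp_out : hom S sp_obj;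
  sp_outin : sp_out \oc sp_in = idm sp_obj;
  sp_inout : sp_in \oc sp_out = e
}.

Section SplitComplexes.
Hypothesis Asplit : idem_split A.

(** A choice of splittings that depends on the idempotent only, so that a
    periodic family of idempotents is split periodically. *)
Definition split_of (S : A) (e : hom S S) (ee : e \oc e = e) : splitting e.
Proof.
apply: inhabited_witness.
by have [Y [a [b [ba ab]]]] := Asplit ee; exists; exists Y a b.
Defined.

Lemma split_of_Arrow S S' (e : hom S S) (e' : hom S' S') ee ee' :
  Arrow e = Arrow e' ->
  Arrow (sp_in (@split_of S e ee)) = Arrow (sp_in (@split_of S' e' ee')) /\
  Arrow (sp_out (@split_of S e ee)) = Arrow (sp_out (@split_of S' e' ee')).
Proof.
move=> eqe; have SS' := Arrow_src eqe.
case: _ / SS' e' ee' eqe => e' ee' /Arrow_inj eqe.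
by case: _ / eqe ee' => ee'; rewrite (Prop_irrelevance ee ee').
Qed.

Section Retract.
Variables (X : complex A) (e : forall i, hom (X i) (X i)).
Hypothesis ee : forall i, e i \oc e i = e i.
Hypothesis ded : forall i j l, cd X j l \oc e j \oc cd X i j = 0.

(** The condition on e is weaker than being a chain map: it also allows the
    idempotents that are 1 in a range of degrees and 0 elsewhere, whose image
    is a brutal truncation. *)
Definition retract_complex : complex A.
Proof.
exists (fun i => sp_obj (split_of (ee i)))
  (fun i j => sp_out (split_of (ee j)) \oc cd X i j \oc sp_in (split_of (ee i))).
- by move=> i j ij; rewrite cd_shape// mcomp0r mcomp0l.
- move=> i j l; rewrite -!mcompA (mcompA (sp_in _)) sp_inout.
  by rewrite !(mcompA (cd X j l)) (mcompA (_ \oc _)) ded mcomp0l mcomp0r.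
Defined.

Definition rc_in i : hom (retract_complex i) (X i) := sp_in (split_of (ee i)).
Definition rc_out i : hom (X i) (retract_complex i) := sp_out (split_of (ee i)).

Lemma rc_outin i : rc_out i \oc rc_in i = idm _. Proof. exact: sp_outin. Qed.
Lemma rc_inout i : rc_in i \oc rc_out i = e i. Proof. exact: sp_inout. Qed.
Lemma rc_cd i j : cd retract_complex i j = rc_out j \oc cd X i j \oc rc_in i.
Proof. by []. Qed.

Lemma rc_zero i : is_zero (X i) -> is_zero (retract_complex i).
Proof. exact: is_zero_retract (rc_outin i). Qed.

Lemma rc_zero0 i : e i = 0 -> is_zero (retract_complex i).
Proof.
move=> e0; rewrite /is_zero -[LHS]mcomp1m -!(rc_outin i) -mcompA (mcompA (rc_in i)).
by rewrite rc_inout e0 mcomp0l mcomp0r.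
Qed.

Hypothesis ed : forall i j, e j \oc cd X i j = cd X i j \oc e i.

Definition rc_inc : chain_map retract_complex X.
Proof.
exists rc_in => i j; rewrite rc_cd !mcompA rc_inout ed -mcompA -rc_inout.
by rewrite -(mcompA (rc_in i)) rc_outin mcompm1.
Defined.

Definition rc_prj : chain_map X retract_complex.
Proof.
exists rc_out => i j; rewrite rc_cd -!mcompA rc_inout -ed -rc_inout.
by rewrite !mcompA rc_outin mcomp1m.
Defined.

Lemma rc_prj_inc : cm_comp rc_prj rc_inc = cm_id _.
Proof. by apply: chain_map_eq => i; exact: rc_outin. Qed.

Lemma rc_inc_prj i : cm_comp rc_inc rc_prj i = e i.
Proof. exact: rc_inout. Qed.

End Retract.

Lemma chain_ded X (e : chain_map X X) i j l : cd X j l \oc e j \oc cd X i j = 0.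
Proof. by rewrite -mcompA cmap_comm mcompA cd_sq mcomp0l. Qed.

Lemma bounded_split : idem_split (bounded_complexes A).
Proof.
move=> X e ee; pose f : chain_map (sval X) (sval X) := e.
have ff i : f i \oc f i = f i by exact: (congr1 (fun h : chain_map _ _ => h i) ee).
pose Y := retract_complex ff (chain_ded f).
have Ybd : bounded Y.
  have [a [b X0]] := svalP X; exists a, b => i /X0; exact: rc_zero.
exists (exist _ Y Ybd), (rc_inc ff (chain_ded f) (cmap_comm f)),
  (rc_prj ff (chain_ded f) (cmap_comm f)); split; first exact: rc_prj_inc.
by apply: chain_map_eq => i; exact: rc_inc_prj.
Qed.

Section PeriodicSplit.
Variable m : nat.

Lemma periodic_split : idem_split (periodic_complexes A m).
Proof.
move=> X e ee; pose f : chain_map X X := pm e.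
have ff i : f i \oc f i = f i.
  exact: (congr1 (fun h : pmap X X => pm h i) ee).
pose Y := retract_complex ff (chain_ded f).
have Yarr (i j : int) : (i = j %[mod m])%Z ->
    Arrow (rc_in ff (chain_ded f) i) = Arrow (rc_in ff (chain_ded f) j) /\
    Arrow (rc_out ff (chain_ded f) i) = Arrow (rc_out ff (chain_ded f) j).
  by move=> ij; apply: split_of_Arrow; exact: pm_per.
have Yper (i j : int) : (i = j %[mod m])%Z ->
    Arrow (cd Y i (i + 1)) = Arrow (cd Y j (j + 1)).
  move=> ij; rewrite !rc_cd.
  have ij1 : (i + 1 = j + 1 %[mod m])%Z by rewrite -modzDml ij modzDml.
  apply: Arrow_comp; last by case: (Yarr _ _ ij).
  by apply: Arrow_comp; [case: (Yarr _ _ ij1)|exact: pc_per].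
pose Z : pcomplex A m := PComplex Yper.
have inP (i j : int) : (i = j %[mod m])%Z ->
    Arrow (rc_inc ff (chain_ded f) (cmap_comm f) i : hom (Z i) (X i)) =
    Arrow (rc_inc ff (chain_ded f) (cmap_comm f) j : hom (Z j) (X j)).
  by case/Yarr.
have outP (i j : int) : (i = j %[mod m])%Z ->
    Arrow (rc_prj ff (chain_ded f) (cmap_comm f) i : hom (X i) (Z i)) =
    Arrow (rc_prj ff (chain_ded f) (cmap_comm f) j : hom (X j) (Z j)).
  by case/Yarr.
exists Z, (PMap inP : pmap Z X), (PMap outP : pmap X Z); split.
  by apply: pmap_eq; exact: rc_prj_inc.
by apply: pmap_eq; apply: chain_map_eq => i; exact: rc_inc_prj.
Qed.

End PeriodicSplit.
End SplitComplexes.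

(** Fitting's idempotents of the components of f assemble into a chain map. *)
Lemma chain_fitting X (f : chain_map X X) n :
  (forall i, exists e, fitting_idem (mpow (f i) n) e) ->
  exists e : chain_map X X, forall i, fitting_idem (mpow (f i) n) (e i).
Proof.
move=> /(_ _)/cid fit; pose e i := projT1 (fit i).
have eP i : fitting_idem (mpow (f i) n) (e i) by exact: projT2 (fit i).
have ed i j : e j \oc cd X i j = cd X i j \oc e i.
  symmetry; apply: fitting_idem_nat (eP i) (eP j) _.
  by rewrite -!cm_pow (cmap_comm (@mpow k (complexes A) X f n : chain_map X X)).
by exists (ChainMap ed).
Qed.

Hypothesis Afin : hom_finite A.

Lemma fitting_bound : exists N : A -> nat, forall S (f : hom S S) M,
  (N S <= M)%N -> exists e, fitting_idem (mpow f M) e.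
Proof.
have /choice[N NP] := fun S => fitting_idem_exists (Afin S S).
by exists N => S f M; exact: NP.
Qed.

Lemma bounded_support (X : bounded_complexes A) :
  exists r : seq int, forall i, i \notin r -> is_zero (sval X i).
Proof.
have [a [b X0]] := svalP X.
exists [seq a + Posz n | n <- iota 0 `|b - a|%N.+1] => i ir; apply: X0.
have [ia|ai] := ltP i a; first by left.
have [bi|ib] := ltP b i; first by right.
case/negP: ir; apply/mapP; exists `|i - a|%N; first by rewrite mem_iota; lia.
lia.
Qed.

(** One exponent serves in all degrees, as only finitely many degrees matter; the
    Fitting idempotent of f is then 0, and f is nilpotent, or it is 1, and f is
    invertible. *)
Lemma bounded_fitting : idem_split A -> fitting (bounded_complexes A).
Proof.
move=> Asplit X f Xind; pose g : chain_map (sval X) (sval X) := f.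
have [N NP] := fitting_bound; have [r rP] := bounded_support X.
have [i|e eP] := @chain_fitting _ g (\max_(i <- r) N (sval X i)).+1.
  have [ir|/rP X0] := boolP (i \in r).
    by apply: NP; apply: leqW; exact: leq_bigmax_seq.
  by exists 0, 0, 0; rewrite mcomp0l mcomp0r; split=> //; rewrite [RHS]is_zero_src.
case: (@idem_indec _ _ (bounded_split Asplit) X e Xind).
- by apply: chain_map_eq => i; exact: fitting_idem_idem (eP i).
- move=> e0; right; eexists; apply: chain_map_eq => i.
  have := eP i; rewrite -cm_pow.
  have -> : e i = 0 by exact: (congr1 (fun h : chain_map _ _ => h i) e0).
  exact: fitting_idem0.
- move=> e1; left; apply: bounded_iso => i; apply: is_iso_mpow (fitting_idem1 _).
  have := eP i.
  have -> : e i = idm _ by exact: (congr1 (fun h : chain_map _ _ => h i) e1).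
  exact.
Qed.

Lemma pm_pow m (X : periodic_complexes A m) (f : hom X X) n i :
  (mpow f n : pmap X X) i = mpow ((f : pmap X X) i) n.
Proof. by elim: n => //= n ->. Qed.

Lemma periodic_fitting m : (0 < m)%N -> idem_split A ->
  fitting (periodic_complexes A m).
Proof.
move=> m0 Asplit X f Xind; pose g : pmap X X := f.
have [N NP] := fitting_bound.
have [i|e eP] := @chain_fitting _ g (\max_(i < m) N ((X : pcomplex A m) i%:Z)).+1.
  have im : (`|(i %% m)%Z|%N < m)%N by lia.
  have iX : (X : pcomplex A m) i = (X : pcomplex A m) `|(i %% m)%Z|%N.
    apply: pc_obj; rewrite -[in LHS]modz_mod; congr (_ %% _)%Z; lia.
  apply: NP; rewrite iX; apply: leqW.
  exact: (@leq_bigmax _ (fun i : 'I_m => N ((X : pcomplex A m) i%:Z)) (Ordinal im)).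
have eper (i j : int) : (i = j %[mod m])%Z -> Arrow (e i) = Arrow (e j).
  move=> ij; apply: fitting_idem_Arrow (eP i) (eP j) _.
  by rewrite -!pm_pow; exact: pm_per.
pose e' : pmap X X := PMap eper.
case: (@idem_indec _ _ (periodic_split Asplit (m := m)) X e' Xind).
- apply: pmap_eq; apply: chain_map_eq => i; exact: fitting_idem_idem (eP i).
- move=> e0; right; eexists; apply: pmap_eq; apply: chain_map_eq => i.
  have := eP i; rewrite -pm_pow.
  have -> : e i = 0 by exact: (congr1 (fun h : pmap _ _ => h i) e0).
  exact: fitting_idem0.
- move=> e1; left; apply: periodic_iso => i; apply: is_iso_mpow (fitting_idem1 _).
  have := eP i.
  have -> : e i = idm _ by exact: (congr1 (fun h : pmap _ _ => h i) e1).
  exact.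
Qed.

(** Splitting off proper summands that are nonzero in degree c must stop, as
    the sum of the lengths of the End (W i) strictly decreases. *)
Lemma indecomposable_retract (W : bounded_complexes A) (c : int) :
  ~ is_zero (sval W c) ->
  exists (W' : bounded_complexes A) (i : hom W' W) (q : hom W W'),
    [/\ indecomposable W', q \oc i = idm W' & ~ is_zero (sval W' c)].
Proof.
have [len lenP] := retract_measure Afin.
have [r rP] := bounded_support W.
have [n] := ubnP (\sum_(i <- r) len (sval W i))%N.
elim: n => // n IH in W rP * => lt_n Wc.
have [Wind|Wdec] := pselect (indecomposable W).
  by exists W, (idm W), (idm W); rewrite mcomp1m.
have W0 : ~ is_zero W by move=> /complex_zeroP/(_ c).
have [Y [d Y0]] : exists (Y : bool -> bounded_complexes A) (d : dirsum predT Y W),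
    forall s, ~ is_zero (Y s).
  apply: contrapT => noY; apply: Wdec; split=> // Y [d].
  apply: contrapT => /not_orP[Yt Yf]; apply: noY; exists Y, d; by case.
pose a s : chain_map (sval (Y s)) (sval W) := ds_inj d s.
pose b s : chain_map (sval W) (sval (Y s)) := ds_prj d s.
have ba s i : b s i \oc a s i = idm _.
  have /(congr1 (fun h : chain_map _ _ => h i)) := ds_prj_inj d (i := s) isT.
  exact.
have ab1 i : a true i \oc b true i + a false i \oc b false i = idm _.
  have := ds_sum_fin d; rewrite big_bool.
  exact: (congr1 (fun h : chain_map _ _ => h i)).
have [s Ysc] : exists s, ~ is_zero (sval (Y s) c).
  apply: contrapT => /forallNP Yz; apply: Wc; rewrite /is_zero -ab1.
  have z s := contrapT (Yz s).
  rewrite [a true c](is_zero_src _ (z true)) [a false c](is_zero_src _ (z false)).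
  by rewrite !mcomp0l addr0.
have Ysr i : i \notin r -> is_zero (sval (Y s) i).
  by move=> /rP; apply: is_zero_retract (ba s i).
have [W' [i [q [W'ind qi W'c]]]] :
    exists (W' : bounded_complexes A) (i : hom W' (Y s)) (q : hom (Y s) W'),
    [/\ indecomposable W', q \oc i = idm W' & ~ is_zero (sval W' c)].
  apply: (IH _ Ysr _ Ysc); rewrite -ltnS; apply: leq_trans lt_n; rewrite ltnS.
  have [i ir abi] : exists2 i, i \in r & a s i \oc b s i <> idm _.
    apply: contrapT => noi; apply: (Y0 (~~ s)).
    have ab : ds_inj d s \oc ds_prj d s = idm W.
      apply: chain_map_eq => i.
      have [ir|/rP Wi] := boolP (i \in r); last first.
        by rewrite [LHS]is_zero_src ?[RHS]is_zero_src.
      by apply: contrapT => abi; apply: noi; exists i.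
    rewrite /is_zero -(ds_prj_inj d)// -[ds_inj d _]mcomp1m -ab -mcompA.
    by rewrite (ds_prj_inj0 d (j := s))// ?mcomp0r//; case: (s).
  rewrite !(big_rem i ir)/= -addSn leq_add//.
    by case: (lenP _ _ _ _ (ba s i)) => _; apply.
  by apply: leq_sum => j _; case: (lenP _ _ _ _ (ba s j)).
exists W', (ds_inj d s \oc i), (q \oc ds_prj d s); split=> //.
by rewrite -mcompA (mcompA (ds_prj d s)) ds_prj_inj// mcomp1m.
Qed.

End ComplexCategories.

(** * The sign of the comparison between a complex and its shifts *)

Section Signs.
Variable k : comPzRingType.

(** This is (-1)^(i(i-1)/2). *)
Definition zigzag (i : int) : k := (-1) ^+ (2 <= (i %% 4)%Z)%R.

Lemma zigzagK i : zigzag i * zigzag i = 1.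
Proof. by rewrite /zigzag -expr2 sqrr_sign. Qed.

Lemma zigzagS i : zigzag (i + 1) = shift_sign k i * zigzag i.
Proof.
rewrite /zigzag /shift_sign -(signr_odd _ `|i|%N) -signr_addb; congr (_ ^+ nat_of_bool _).
have [q [r [-> [-> r4]]]] :
    exists q r, i = q * 4 + r /\ (i %% 4)%Z = r /\ (0 <= r < 4)%R.
  exists (i %/ 4)%Z, (i %% 4)%Z; rewrite -divz_eq; split=> //; split=> //; lia.
lia.
Qed.

Lemma shift_signK t : shift_sign k t * shift_sign k t = 1.
Proof. by rewrite /shift_sign -exprD addnn -mul2n exprM sqrrN !expr1n. Qed.

(** The differential of X[p] is (-1)^p d, while that of the compression involves no
    sign, so that the identities of the X^(i + p) do not form chain maps from X[p]
    to the compression; these signs make them chain maps.  As they are the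
    coboundary of zigzag, they are compatible with the composition of shifts. *)
Definition shift_corr (p i : int) : k := zigzag i * zigzag (i + p).

Lemma shift_corrK p i : shift_corr p i * shift_corr p i = 1.
Proof. by rewrite /shift_corr mulrACA !zigzagK mulr1. Qed.

Lemma shift_corrD p q i : shift_corr p i * shift_corr q (i + p) = shift_corr (q + p) i.
Proof.
rewrite /shift_corr -mulrA (mulrA (zigzag (i + p))) zigzagK mul1r.
by rewrite -addrA (addrC p).
Qed.

Lemma shift_corrS p i : shift_corr p (i + 1) = shift_sign k p * shift_corr p i.
Proof.
rewrite /shift_corr addrAC !zigzagS shift_signD mulrACA; congr (_ * _).
by rewrite mulrA shift_signK mul1r.
Qed.

End Signs.

(** * Components of maps between direct sums *)

Lemma sum_only (V : zmodType) (I : eqType) (r : seq I) (f : I -> V) (i : I) :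
  uniq r -> (forall j, j \in r -> j != i -> f j = 0) -> (i \notin r -> f i = 0) ->
  \sum_(j <- r) f j = f i.
Proof.
move=> ur f0 fi; have [ir|/[dup] ir /fi ->] := boolP (i \in r).
  by rewrite (bigD1_seq i)//= big_seq_cond big1 ?addr0// => j /andP[]; exact: f0.
by rewrite big_seq big1// => j jr; apply: f0 => //; apply: contraNneq ir => <-.
Qed.

Section Diagonal.
Variables (k : comPzRingType) (A : kcat k).

Lemma inj_of_prj (I J : eqType) (P : pred I) (Q : pred J) (X : I -> A) (Y : J -> A)
    (S T : A) (d : dirsum P X S) (e : dirsum Q Y T) (p : I -> J) (f : hom S T)
    (h : forall i, hom (X i) (Y (p i))) :
  injective p -> (forall i, P i -> Q (p i)) ->
  (forall j, Q j -> exists2 i, P i & p i = j) ->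
  (forall i, P i -> ds_prj e (p i) \oc f = h i \oc ds_prj d i) ->
  forall i, P i -> f \oc ds_inj d i = ds_inj e (p i) \oc h i.
Proof.
move=> pI PQ QP fh i Pi; apply: (prj_ext (d := e)) => _ /QP[j Pj <-].
rewrite mcompA fh// mcompA; have [<-|ij] := eqVneq i j.
  by rewrite -mcompA !ds_prj_inj// ?mcomp1m ?mcompm1//; exact: PQ.
by rewrite -mcompA !ds_prj_inj0// ?mcomp0l ?mcomp0r ?(inj_eq pI)//; exact: PQ.
Qed.

Lemma sum_prj_inj (I : eqType) (P : pred I) (X : I -> A) (S T : A)
    (d : dirsum P X S) (h : forall i, hom (X i) T) (i : I) : P i ->
  (\sum_(j <- ds_supp d) h j \oc ds_prj d j) \oc ds_inj d i = h i.
Proof.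
move=> Pi; rewrite mcomp_suml (sum_only (i := i)) ?ds_supp_uniq//.
- by rewrite -mcompA ds_prj_inj// mcompm1.
- by move=> l /(ds_suppP) Pl li; rewrite -mcompA ds_prj_inj0 ?mcomp0r// eq_sym.
- by move=> si; rewrite [h i](is_zero_src _ (ds_zero Pi si)) !mcomp0l.
Qed.

Lemma prj_sum_inj (I : eqType) (P : pred I) (X : I -> A) (S T : A)
    (d : dirsum P X S) (h : forall i, hom T (X i)) (i : I) : P i ->
  ds_prj d i \oc (\sum_(j <- ds_supp d) ds_inj d j \oc h j) = h i.
Proof.
move=> Pi; rewrite mcomp_sumr (sum_only (i := i)) ?ds_supp_uniq//.
- by rewrite mcompA ds_prj_inj// mcomp1m.
- by move=> l /(ds_suppP) Pl li; rewrite mcompA ds_prj_inj0 ?mcomp0l.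
- by move=> si; rewrite [h i](is_zero_tgt _ (ds_zero Pi si)) !mcomp0r.
Qed.

End Diagonal.

(** * The compression of X as the direct sum of the shifts of X *)

Lemma cm_step (k : comPzRingType) (A : kcat k) (X Y : complex A)
    (f : forall i, hom (X i) (Y i)) :
  (forall i, f (i + 1) \oc cd X i (i + 1) = cd Y i (i + 1) \oc f i) ->
  forall i j, f j \oc cd X i j = cd Y i j \oc f i.
Proof.
move=> h i j; have [->//|ij] := eqVneq j (i + 1).
by rewrite !cd_shape// mcomp0l mcomp0r.
Qed.

Section Compression.
Variables (k : comPzRingType) (A : kcat k) (Aadd : is_additive A) (m : nat).
Implicit Types (X Y : bounded_complexes A) (g : int).

Local Notation res := (residue m).
Local Notation CC := (compr_complex Aadd m).
Local Notation F := (compression Aadd m).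
Local Notation sh := (shift_action A m).

Definition compr_inj X r j : hom (sval X j) (CC X r) := ds_inj (compr_ds Aadd X (res r)) j.
Definition compr_prj X r j : hom (CC X r) (sval X j) := ds_prj (compr_ds Aadd X (res r)) j.

Local Notation cinj := compr_inj.
Local Notation cprj := compr_prj.

Lemma residue_refl r : res r r. Proof. exact: eqxx. Qed.

Lemma residue_shift g r j : res r (j + g * m%:Z) = res r j.
Proof. by rewrite /residue addrC modzMDl. Qed.

Lemma cprj_inj X r j : res r j -> cprj X r j \oc cinj X r j = idm _.
Proof. exact: ds_prj_inj. Qed.

Lemma cprj_inj0 X r i j : res r i -> res r j -> i != j ->
  cprj X r j \oc cinj X r i = 0.
Proof. exact: ds_prj_inj0. Qed.

Lemma cprj_ext X r (S : A) (f f' : hom S (CC X r)) :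
  (forall j, res r j -> cprj X r j \oc f = cprj X r j \oc f') -> f = f'.
Proof. exact: prj_ext. Qed.

Lemma cinj_ext X r (S : A) (f f' : hom (CC X r) S) :
  (forall j, res r j -> f \oc cinj X r j = f' \oc cinj X r j) -> f = f'.
Proof. exact: inj_ext. Qed.

Lemma cd_CC X r : cd (CC X) r (r + 1) = compr_diff Aadd X (res r) (res (r + 1)).
Proof. by rewrite /= /compr_d eqxx. Qed.

Lemma cprj_cd X r j l : res r j -> l = j + 1 ->
  cprj X (r + 1) l \oc cd (CC X) r (r + 1) = cd (sval X) j l \oc cprj X r j.
Proof. by move=> rj ->; rewrite cd_CC; exact: compr_diffE. Qed.

Lemma cd_cinj X r j l : res r j -> l = j + 1 ->
  cd (CC X) r (r + 1) \oc cinj X r j = cinj X (r + 1) l \oc cd (sval X) j l.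
Proof.
move=> rj ->; rewrite cd_CC.
apply: (inj_of_prj (p := fun j : int => j + 1)
  (h := fun j => cd (sval X) j (j + 1)) (@addIr _ _)) => //.
- by move=> i; rewrite residueS.
- by move=> i; rewrite -[i](subrK 1) -residueS; exists (i - 1).
- by move=> i ri; exact: compr_diffE.
Qed.

Lemma cprj_map X Y (f : hom X Y) r j : res r j ->
  cprj Y r j \oc (fmap F f : pmap (F X) (F Y)) r =
  (f : chain_map (sval X) (sval Y)) j \oc cprj X r j.
Proof. exact: compr_mapE. Qed.

Lemma map_cinj X Y (f : hom X Y) r j : res r j ->
  (fmap F f : pmap (F X) (F Y)) r \oc cinj X r j =
  cinj Y r j \oc (f : chain_map (sval X) (sval Y)) j.
Proof.
move: j; apply: (inj_of_prj (p := id)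
  (h := (f : chain_map (sval X) (sval Y)))) => //.
- by move=> j rj; exists j.
- by move=> j rj; exact: compr_mapE.
Qed.

Lemma cd_sh g X i j : cd (sval (sh g X)) i j =
  shift_sign k (g * m%:Z) *: cd (sval X) (i + g * m%:Z) (j + g * m%:Z).
Proof. by []. Qed.

(** ** The inclusions and projections of the direct sum *)

(** When periodicity is forgotten, the compression of X is the direct sum of the
    shifts X[gm], with inclusions [sh_in g] and projections [sh_out g].  For X itself,
    which is equal but not convertible to X[0], they are [id_in] and [id_out]. *)

Definition sh_in g X : chain_map (sval (sh g X)) (CC X).
Proof.
exists (fun i => shift_corr k (g * m%:Z) i *: cinj X i (i + g * m%:Z)).
apply: cm_step => i; rewrite cd_sh mcompZl !mcompZr.
rewrite (@cd_cinj X i (i + g * m%:Z) (i + 1 + g * m%:Z)) ?residue_shift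
  ?residue_refl//; last by rewrite addrAC.
by rewrite scalerA shift_corrS mulrAC mulrC shift_signK mulr1.
Defined.

Definition sh_out g X : chain_map (CC X) (sval (sh g X)).
Proof.
exists (fun i => shift_corr k (g * m%:Z) i *: cprj X i (i + g * m%:Z)).
apply: cm_step => i.
rewrite mcompZl (@cprj_cd X i (i + g * m%:Z)) ?residue_shift ?residue_refl//.
  by rewrite cd_sh mcompZr mcompZl scalerA shift_corrS mulrC.
by rewrite addrAC.
Defined.

Definition id_in X : chain_map (sval X) (CC X).
Proof.
exists (fun i => cinj X i i).
by apply: cm_step => i; rewrite (cd_cinj _ (l := i + 1)) ?residue_refl.
Defined.

Definition id_out X : chain_map (CC X) (sval X).
Proof.
exists (fun i => cprj X i i).
by apply: cm_step => i; rewrite (cprj_cd _ (j := i)) ?residue_refl.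
Defined.

(** ** The stabilizer *)

Section Stab.
Variables (g : int) (X : bounded_complexes A).
Let p := g * m%:Z.
Let ds (Z : bounded_complexes A) r := compr_ds Aadd Z (res r).

Definition stab_deg r : hom (CC (sh g X) r) (CC X r) :=
  \sum_(j <- ds_supp (ds (sh g X) r))
    ds_inj (ds X r) (j + p) \oc (shift_corr k p j *: idm (sval X (j + p)))
      \oc ds_prj (ds (sh g X) r) j.

Definition stabV_deg r : hom (CC X r) (CC (sh g X) r) :=
  \sum_(j <- ds_supp (ds (sh g X) r))
    ds_inj (ds (sh g X) r) j \oc (shift_corr k p j *: ds_prj (ds X r) (j + p)).

Lemma prj_stab r j : res r j ->
  cprj X r (j + p) \oc stab_deg r = shift_corr k p j *: cprj (sh g X) r j.
Proof.
move=> rj; rewrite -[cprj (sh g X) r j]mcomp1m -mcompZl.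
apply: (prj_diag (p := fun j : int => j + p)) => //; first exact: addIr.
by move=> i; rewrite residue_shift.
Qed.

Lemma prj_stabV r j : res r j ->
  cprj (sh g X) r j \oc stabV_deg r = shift_corr k p j *: cprj X r (j + p).
Proof.
move=> rj.
exact: (prj_sum_inj _ (fun j => shift_corr k p j *: ds_prj (ds X r) (j + p))).
Qed.

Lemma stab_inj r j : res r j ->
  stab_deg r \oc cinj (sh g X) r j = shift_corr k p j *: cinj X r (j + p).
Proof.
move=> rj; rewrite -[cinj X r _]mcompm1 -mcompZr.
apply: (inj_of_prj (p := fun j : int => j + p)
  (h := fun j => shift_corr k p j *: idm (sval X (j + p))) (@addIr _ _)) => //.
- by move=> i; rewrite residue_shift.
- by move=> i ri; exists (i - p); rewrite ?subrK// -(residue_shift g) subrK.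
- by move=> i ri; rewrite mcompZl mcomp1m; exact: prj_stab.
Qed.

Lemma shifted_ext r (S : A) (f f' : hom S (CC X r)) :
  (forall j, res r j -> cprj X r (j + p) \oc f = cprj X r (j + p) \oc f') -> f = f'.
Proof.
move=> ff; apply: cprj_ext => j rj; rewrite -[j](subrK p); apply: ff.
by rewrite -(residue_shift g) subrK.
Qed.

Lemma stab_degK r : stabV_deg r \oc stab_deg r = idm _.
Proof.
apply: cprj_ext => j rj; rewrite mcompA prj_stabV// mcompZl prj_stab//.
by rewrite scalerA shift_corrK scale1r mcompm1.
Qed.

Lemma stabV_degK r : stab_deg r \oc stabV_deg r = idm _.
Proof.
apply: shifted_ext => j rj; rewrite mcompA prj_stab// mcompZl prj_stabV//.
by rewrite scalerA shift_corrK scale1r mcompm1.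
Qed.

Lemma stab_comm i j :
  stab_deg j \oc cd (CC (sh g X)) i j = cd (CC X) i j \oc stab_deg i.
Proof.
move: i j; apply: cm_step => i; apply: shifted_ext => j.
rewrite -[j](subrK 1) -residueS => ij.
rewrite mcompA prj_stab -?residueS// mcompZl (cprj_cd _ (j := j - 1))//.
rewrite mcompA (cprj_cd _ (j := j - 1 + p)) ?residue_shift//; last by rewrite addrAC.
rewrite -mcompA prj_stab// mcompZr cd_sh mcompZl scalerA shift_corrS.
by rewrite -/p mulrAC shift_signK mul1r.
Qed.

Lemma stab_per (i j : int) : (i = j %[mod m])%Z -> Arrow (stab_deg i) = Arrow (stab_deg j).
Proof. by move=> ij; rewrite /stab_deg /ds /= (residue_eq ij). Qed.

Lemma stabV_comm i j :
  stabV_deg j \oc cd (CC X) i j = cd (CC (sh g X)) i j \oc stabV_deg i.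
Proof. exact: iso_comm (stabV_degK i) (stab_degK j) (stab_comm i j). Qed.

Lemma stabV_per (i j : int) : (i = j %[mod m])%Z -> Arrow (stabV_deg i) = Arrow (stabV_deg j).
Proof. by move=> ij; rewrite /stabV_deg /ds /= (residue_eq ij). Qed.

Definition compr_stab : pmap (F (sh g X)) (F X) :=
  @PMap _ _ _ (F (sh g X)) (F X) (@ChainMap _ _ (CC (sh g X)) (CC X) _ stab_comm) stab_per.

Definition compr_stabV : pmap (F X) (F (sh g X)) :=
  @PMap _ _ _ (F X) (F (sh g X)) (@ChainMap _ _ (CC X) (CC (sh g X)) _ stabV_comm) stabV_per.

End Stab.

(** Since Z and Z' are equal but not convertible, f and f' have different types; their
    restrictions to the summands Z^j and Z'^j can still be compared. *)
Lemma Arrow_compr_src (Z Z' X : bounded_complexes A) (f : pmap (F Z) (F X))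
    (f' : pmap (F Z') (F X)) :
  Z = Z' ->
  (forall r j, res r j -> Arrow (f r \oc cinj Z r j) = Arrow (f' r \oc cinj Z' r j)) ->
  @Arrow k (periodic_complexes A m) (F Z) (F X) f = 
  @Arrow k (periodic_complexes A m) (F Z') (F X) f'.
Proof.
move=> ZZ'; case: _ / ZZ' f' => f' ff; congr Arrow.
apply: pmap_eq; apply: chain_map_eq => r; apply: cinj_ext => j rj.
exact: Arrow_inj (ff r j rj).
Qed.

(** The signs of the component X^(i + (g + h) m) are the products
    zigzag(i) zigzag(i + gm) and zigzag(i + gm) zigzag(i + (g + h) m) on one side of
    the cocycle condition, and zigzag(i) zigzag(i + (g + h) m) on the other. *)
Definition stabilizer_compression : stabilizer sh F.
Proof.
refine (@Stabilizer k _ _ _ sh F compr_stab compr_stabV _ _ _ _).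
- by move=> g X; apply: pmap_eq; apply: chain_map_eq => r; exact: stab_degK.
- by move=> g X; apply: pmap_eq; apply: chain_map_eq => r; exact: stabV_degK.
- move=> g X Y f; apply: pmap_eq; apply: chain_map_eq => r /=.
  apply: (@shifted_ext g) => j rj.
  rewrite mcompA prj_stab// mcompZl (cprj_map (fmap (sh g) f))//.
  by rewrite mcompA cprj_map ?residue_shift// -mcompA prj_stab// mcompZr.
- move=> g h X; apply: Arrow_compr_src.
    exact: Arrow_src (gactM sh g h (idm X)).
  move=> r j rj.
  have e1 : (stab_deg h X r \oc stab_deg g (sh h X) r) \oc cinj (sh g (sh h X)) r j =
      shift_corr k (h * m%:Z + g * m%:Z) j *: cinj X r (j + g * m%:Z + h * m%:Z).
    rewrite -mcompA stab_inj// mcompZr (@stab_inj h X) ?residue_shift//.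
    by rewrite scalerA shift_corrD.
  have e2 := @stab_inj (g + h) X r j rj.
  apply: (etrans (congr1 Arrow e1)); apply/esym; apply: (etrans (congr1 Arrow e2)).
  have e3 l l' c c' : l = l' -> c = c' ->
    Arrow (c *: cinj X r l) = Arrow (c' *: cinj X r l') by move=> -> ->.
  by apply: e3; rewrite ?mulrDl ?(addrC (h * _)) ?addrA.
Defined.

End Compression.

(** * The precovering property *)

Lemma bij_of_inj_surj (T U : Type) (f : T -> U) :
  injective f -> (forall y, exists x, f x = y) -> bijective f.
Proof.
move=> fI /choice[g gf]; exists g => // x; apply: fI; exact: gf.
Qed.

Lemma finfam_eq (k : comPzRingType) (I : choiceType) (M : I -> lmodType k)
    (u v : finfam M) : (forall i, u i = v i) -> u = v.
Proof.
case: u v => [u uf] [v vf] /= uv.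
have e : u = v by apply: functional_extensionality_dep.
by case: _ / e vf {uv} => vf; rewrite (Prop_irrelevance uf vf).
Qed.

Lemma fsum_seq (V : zmodType) (I : choiceType) (r : seq I) (f : I -> V) :
  uniq r -> (forall i, i \notin r -> f i = 0) ->
  \sum_(i \in [set: I]) f i = \sum_(i <- r) f i.
Proof.
move=> ur f0; rewrite (@fsbigE _ _ _ _ _ r)//; last by move=> i _; exact: f0.
by apply: eq_bigl => i; rewrite in_setT.
Qed.

Lemma fmap0 (k : comPzRingType) (C D : kcat k) (F : kfunctor C D) (X Y : C) :
  fmap F (0 : hom X Y) = 0.
Proof.
by have := fmap_lin F (-1) (0 : hom X Y) 0; rewrite scaler0 addr0 scaleN1r addNr.
Qed.

Section Precovering.
Variables (k : comPzRingType) (A : kcat k) (Aadd : is_additive A) (m : nat).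
Hypothesis m0 : (0 < m)%N.
Implicit Types (X Y V : bounded_complexes A) (g : int).

Local Notation res := (residue m).
Local Notation CC := (compr_complex Aadd m).
Local Notation F := (compression Aadd m).
Local Notation sh := (shift_action A m).
Local Notation delta := (stabilizer_compression Aadd m).
Local Notation cinj := (@compr_inj k A Aadd m).
Local Notation cprj := (@compr_prj k A Aadd m).
Local Notation "g \cc f" := (@mcomp k (complexes A) _ _ _ g f)
  (at level 40, left associativity).

(** Only finitely many shifts of Y meet the support of X.  All finiteness
    properties come from this list; it contains 0, so that the summand X = X[0] can
    always be singled out. *)
Lemma common_degrees X Y : exists G : seq zgroup, [/\ uniq G, (0 : int) \in G &
  forall g, g \notin G -> forall i,
    is_zero (sval X i) \/ is_zero (sval Y (i + g * m%:Z))].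
Proof.
have [a [b X0]] := svalP X; have [c [d Y0]] := svalP Y.
pose B := (`|c - b| + `|d - a|)%N.
exists [seq n%:Z - B%:Z | n <- iota 0 (B + B).+1]; split.
- by rewrite map_inj_uniq ?iota_uniq// => x y /addIr[].
- by apply/mapP; exists B; rewrite ?subrr// mem_iota; lia.
- move=> g gB i.
  have [ia|ai] := ltP i a; first by left; apply: X0; left.
  have [bi|ib] := ltP b i; first by left; apply: X0; right.
  right; apply: Y0.
  have [gc|cg] := ltP (i + g * m%:Z) c; first by left.
  have [dg|gd] := ltP d (i + g * m%:Z); first by right.
  case/negP: gB; apply/mapP; exists (absz (g + B%:Z)); last by nia.
  by rewrite mem_iota; nia.
Qed.

Lemma hom_shift0 X Y g (u : hom X (sh g Y)) :
  (forall i, is_zero (sval X i) \/ is_zero (sval Y (i + g * m%:Z))) -> u = 0.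
Proof.
move=> z; apply: chain_map_eq => i.
by case: (z i) => [/is_zero_src|/is_zero_tgt]; apply.
Qed.

Lemma hom_shift0r X Y g (u : hom (sh g X) Y) :
  (forall i, is_zero (sval Y i) \/ is_zero (sval X (i + g * m%:Z))) -> u = 0.
Proof.
move=> z; apply: chain_map_eq => i.
by case: (z i) => [/is_zero_tgt|/is_zero_src]; apply.
Qed.

Lemma pm_sumE (Z Z' : pcomplex A m) (J : Type) (r : seq J) (f : J -> pmap Z Z') i :
  (\sum_(j <- r) f j : pmap Z Z') i = \sum_(j <- r) f j i.
Proof.
elim: r => [|j r IH]; first by rewrite !big_nil.
by rewrite !big_cons -IH pmD.
Qed.

Lemma residueP r i j : res r i -> res r j -> exists g, j = i + g * m%:Z.
Proof.
rewrite /residue => /eqP ri /eqP rj; exists ((j - i) %/ m)%Z.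
have /divzK -> : (m %| j - i)%Z by rewrite -eqz_mod_dvd; apply/eqP; rewrite rj ri.
by rewrite addrC subrK.
Qed.

Lemma shift_inj (i : int) g h : g != h -> i + g * m%:Z != i + h * m%:Z.
Proof. by move=> gh; rewrite (inj_eq (addrI _)) (inj_eq (mulIf _))//; lia. Qed.

(** By periodicity, the components X^i -> Y^j of f do not depend on the degree
    r in the residue class of i and j in which they are read off. *)
Lemma entry_per X Y (f : pmap (F X) (F Y)) (r r' i j : int) :
  (r = r' %[mod m])%Z ->
  cprj Y r j \oc f r \oc cinj X r i = cprj Y r' j \oc f r' \oc cinj X r' i.
Proof.
move=> rr'; have := pm_per f rr'; rewrite /compr_prj /compr_inj.
move: (pm f r) (pm f r') => /=.
have gen (P Q : pred int) (a : hom (compr_sum Aadd X P) (compr_sum Aadd Y P))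
    (b : hom (compr_sum Aadd X Q) (compr_sum Aadd Y Q)) : P = Q ->
    Arrow a = Arrow b ->
    ds_prj (compr_ds Aadd Y P) j \oc a \oc ds_inj (compr_ds Aadd X P) i =
    ds_prj (compr_ds Aadd Y Q) j \oc b \oc ds_inj (compr_ds Aadd X Q) i.
  by move=> e; case: _ / e b => b /Arrow_inj ->.
by move=> a b; apply: gen; exact: residue_eq.
Qed.

Lemma stab_map_inj X Y g (u : hom X (sh g Y)) r i : res r i ->
  (stab delta g Y \oc fmap F u : pmap (F X) (F Y)) r \oc cinj X r i =
  cinj Y r (i + g * m%:Z) \oc
    (shift_corr k (g * m%:Z) i *: (u : chain_map (sval X) (sval (sh g Y))) i).
Proof.
move=> ri; rewrite /= -mcompA (map_cinj Aadd u ri) mcompA (stab_inj Aadd g Y ri).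
by rewrite mcompZl mcompZr.
Qed.

Lemma prj_map_stabV X Y g (v : hom (sh g X) Y) r j : res r j ->
  cprj Y r j \oc (fmap F v \oc stabV delta g X : pmap (F X) (F Y)) r =
  (shift_corr k (g * m%:Z) j *: (v : chain_map (sval (sh g X)) (sval Y)) j)
    \oc cprj X r (j + g * m%:Z).
Proof.
move=> rj; rewrite /= mcompA (cprj_map Aadd v rj) -mcompA (prj_stabV Aadd g X rj).
by rewrite mcompZl mcompZr.
Qed.

Lemma sum_stab_entry X Y (u : forall g, hom X (sh g Y)) (G : seq zgroup) r i g0 :
  uniq G -> res r i -> (g0 \notin G -> u g0 = 0) ->
  cprj Y r (i + g0 * m%:Z) \oc
    ((\sum_(g <- G) (stab delta g Y \oc fmap F (u g)) : pmap (F X) (F Y)) r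
      \oc cinj X r i) =
  shift_corr k (g0 * m%:Z) i *: (u g0 : chain_map (sval X) (sval (sh g0 Y))) i.
Proof.
move=> uG ri uG0; rewrite pm_sumE mcomp_suml mcomp_sumr.
rewrite (sum_only (i := g0))//.
- by rewrite stab_map_inj// mcompA cprj_inj ?residue_shift// mcomp1m.
- move=> g _ gg0; rewrite stab_map_inj// mcompA.
  by rewrite cprj_inj0 ?residue_shift ?mcomp0l// shift_inj.
- by move=> /uG0 u0; rewrite stab_map_inj// u0 scaler0 !mcomp0r.
Qed.

Lemma precov_l_seq X Y (u : finfam (fun g : zgroup => hom X (sh g Y))) (G : seq zgroup) :
  uniq G -> (forall g, g \notin G -> u g = 0) ->
  precov_l delta u = \sum_(g <- G) (stab delta g Y \oc fmap F (u g)).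
Proof.
move=> uG u0; by apply: fsum_seq => // g /u0 ->; rewrite fmap0 mcomp0r.
Qed.

(** The component in Hom(X, Y[gm]) is recovered as the composition of f with the
    inclusion of X into F X and the projection of F Y onto Y[gm]. *)
Lemma precov_l_bij X Y : bijective (@precov_l k _ _ _ sh F delta X Y).
Proof.
have [G [uG _ G0]] := common_degrees X Y.
have u0 (u : forall g, hom X (sh g Y)) g : g \notin G -> u g = 0.
  by move=> gG; apply: hom_shift0; exact: G0.
apply: bij_of_inj_surj => [u v|f].
  rewrite !(precov_l_seq uG (u0 _)) => uv; apply: finfam_eq => g.
  apply: chain_map_eq => i.
  have ent w := @sum_stab_entry X Y w G i i g uG (residue_refl m i) (u0 w g).
  have := ent u; rewrite uv (ent v) => /(congr1 (fun f => shift_corr k (g * m%:Z) i *: f)).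
  by rewrite !scalerA shift_corrK !scale1r.
pose w g : hom X (sh g Y) :=
  sh_out Aadd m g Y \cc (f : pmap (F X) (F Y)) \cc id_in Aadd m X.
have wfin : finite_set [set g | w g <> 0].
  apply: (sub_finite_set (B := [set` G])); last exact: finite_seq.
  by move=> g /= wg; apply: contrapT => /negP /(u0 w).
exists (FinFam wfin); rewrite (precov_l_seq uG (u0 _)).
apply: pmap_eq; apply: chain_map_eq => r.
apply: cinj_ext => i ri; apply: cprj_ext => j rj.
have [g ->] := residueP ri rj.
rewrite sum_stab_entry//; last exact: u0.
rewrite [LHS]/= mcompZl mcompZl scalerA shift_corrK scale1r mcompA.
by apply: entry_per; exact/eqP.
Qed.

Lemma sum_stabV_entry X Y (v : forall g, hom (sh g X) Y) (G : seq zgroup) r j g0 :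
  uniq G -> res r j -> (g0 \notin G -> v g0 = 0) ->
  cprj Y r j \oc
    ((\sum_(g <- G) (fmap F (v g) \oc stabV delta g X) : pmap (F X) (F Y)) r
      \oc cinj X r (j + g0 * m%:Z)) =
  shift_corr k (g0 * m%:Z) j *: (v g0 : chain_map (sval (sh g0 X)) (sval Y)) j.
Proof.
move=> uG rj vG0; rewrite pm_sumE mcomp_suml mcomp_sumr.
rewrite (sum_only (i := g0))//.
- by rewrite mcompA prj_map_stabV// -mcompA cprj_inj ?residue_shift// mcompm1.
- move=> g _ gg0; rewrite mcompA prj_map_stabV// -mcompA.
  by rewrite cprj_inj0 ?residue_shift ?mcomp0r// shift_inj// eq_sym.
- by move=> /vG0 v0; rewrite mcompA prj_map_stabV// v0 scaler0 !mcomp0l.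
Qed.

Lemma precov_r_seq X Y (v : finfam (fun g : zgroup => hom (sh g X) Y)) (G : seq zgroup) :
  uniq G -> (forall g, g \notin G -> v g = 0) ->
  precov_r delta v = \sum_(g <- G) (fmap F (v g) \oc stabV delta g X).
Proof.
by move=> uG v0; apply: fsum_seq => // g /v0 ->; rewrite fmap0 mcomp0l.
Qed.

(** The component in Hom(X[gm], Y) is the composition of f with the inclusion of X[gm]
    into F X and the projection of F Y onto Y. *)
Lemma precov_r_bij X Y : bijective (@precov_r k _ _ _ sh F delta X Y).
Proof.
have [G [uG _ G0]] := common_degrees Y X.
have v0 (v : forall g, hom (sh g X) Y) g : g \notin G -> v g = 0.
  by move=> gG; apply: hom_shift0r; exact: G0.
apply: bij_of_inj_surj => [u v|f].
  rewrite !(precov_r_seq uG (v0 _)) => uv; apply: finfam_eq => g.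
  apply: chain_map_eq => i.
  have ent w := @sum_stabV_entry X Y w G i i g uG (residue_refl m i) (v0 w g).
  have := ent u; rewrite uv (ent v) => /(congr1 (fun f => shift_corr k (g * m%:Z) i *: f)).
  by rewrite !scalerA shift_corrK !scale1r.
pose w g : hom (sh g X) Y :=
  id_out Aadd m Y \cc (f : pmap (F X) (F Y)) \cc sh_in Aadd m g X.
have wfin : finite_set [set g | w g <> 0].
  apply: (sub_finite_set (B := [set` G])); last exact: finite_seq.
  by move=> g /= wg; apply: contrapT => /negP /(v0 w).
exists (FinFam wfin); rewrite (precov_r_seq uG (v0 _)).
apply: pmap_eq; apply: chain_map_eq => r.
apply: cinj_ext => i ri; apply: cprj_ext => j rj.
have [g ->] := residueP rj ri.
rewrite sum_stabV_entry//; last exact: v0.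
rewrite [LHS]/= mcompZr scalerA shift_corrK scale1r mcompA.
by apply: entry_per; exact/eqP.
Qed.

Lemma compression_precovering : precovering sh F.
Proof.
exists delta => X Y; split; [exact: precov_l_bij|exact: precov_r_bij].
Qed.

(** * Admissibility *)

Lemma isom_zero_deg X Y : isom X Y -> forall i, is_zero (sval X i) <-> is_zero (sval Y i).
Proof.
move=> [f [f' [f'f ff']]] i; split.
- apply: (is_zero_retract (p := (f' : chain_map _ _) i) (q := (f : chain_map _ _) i)).
  exact: (congr1 (fun h : chain_map (sval Y) (sval Y) => h i) ff').
- apply: (is_zero_retract (p := (f : chain_map _ _) i) (q := (f' : chain_map _ _) i)).
  exact: (congr1 (fun h : chain_map (sval X) (sval X) => h i) f'f).
Qed.

(** The support of a nonzero bounded complex is not invariant under a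
    nontrivial translation; this is why the action is free. *)
Lemma periodic_zero X p : p != 0 ->
  (forall i, is_zero (sval X i) <-> is_zero (sval X (i + p))) -> is_zero X.
Proof.
move=> p0 iso; have [a [b Xab]] := svalP X.
apply: (proj2 (complex_zeroP (sval X))) => i.
have iter_iso (l : nat) : is_zero (sval X i) <-> is_zero (sval X (i + l%:Z * p)).
  elim: l => [|l IH]; first by rewrite mul0r addr0.
  rewrite IH iso; have -> // : i + l.+1%:Z * p = i + l%:Z * p + p.
  by rewrite -addn1 PoszD mulrDl mul1r addrA.
apply/(iter_iso (`|i - a| + `|b - i|).+1); apply: Xab.
have [gn|gp] := ltP p 0; [left|right]; nia.
Qed.

Lemma shift_free X g h : indecomposable X -> g != h -> ~ isom (sh g X) (sh h X).
Proof.
move=> [X0 _] gh /isom_zero_deg iso; apply: X0.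
apply: (@periodic_zero X ((h - g) * m%:Z)).
  by rewrite mulf_neq0// ?subr_eq0; [rewrite eq_sym|lia].
move=> i; have := iso (i - g * m%:Z); rewrite /= subrK.
by rewrite mulrBl addrA addrAC.
Qed.

Lemma sh0 X : sh (0 : int) X = X.
Proof. exact: Arrow_src (gact1 sh (idm X)). Qed.

Lemma shK X g : sh (- g) (sh g X) = X.
Proof.
rewrite -[RHS]sh0 -(addNr g).
exact: Arrow_src (gactM sh (- g) g (idm X)).
Qed.

Lemma shift_admissible : admissible sh.
Proof.
split=> [X g Xind /eqP g0|X Y _ _].
  by rewrite -[in X in isom _ X](sh0 X); exact: shift_free.
have [G [_ _ G0]] := common_degrees X Y.
apply: (sub_finite_set (B := [set` G])); last exact: finite_seq.
move=> g /= [f f0]; apply: contrapT => /negP gG; apply: f0.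
by apply: hom_shift0; exact: G0.
Qed.

End Precovering.

(** * Indecomposable summands of periodic complexes *)

Section Truncation.
Variables (k : comPzRingType) (A : kcat k).
Hypotheses (Asplit : idem_split A) (Afin : hom_finite A).
Variable n : nat.
Hypothesis Hind : forall X : bounded_complexes A, indecomposable X ->
  exists (Y : complexes_1n A n) (t : int),
    indecomposable Y /\ isom X (shift A t (sval Y)).

Lemma indecomposable_width (W : bounded_complexes A) (c j : int) :
  indecomposable W -> ~ is_zero (sval W c) -> ~ is_zero (sval W j) ->
  c - n%:Z < j < c + n%:Z.
Proof.
move=> /Hind[Y [t [_ iso]]] Wc Wj.
have in1n i : ~ is_zero (sval W i) -> 1 <= i + t <= n%:Z.
  move=> Wi; apply: contrapT => /negP it; apply: Wi.
  by apply/(isom_zero_deg iso); apply: (svalP Y).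
have := in1n _ Wc; have := in1n _ Wj; lia.
Qed.

(** A brutal truncation of Z to an interval around a degree c with Z^c <> 0 has an
    indecomposable summand W with W^c <> 0.  If the interval is wide enough, W
    vanishes at both of its ends, and then the inclusion and the projection of W
    are chain maps for Z itself. *)
Lemma bounded_summand (Z : complex A) (c : int) : ~ is_zero (Z c) ->
  exists (W : bounded_complexes A) (i : chain_map (sval W) Z)
    (q : chain_map Z (sval W)), indecomposable W /\ cm_comp q i = cm_id (sval W).
Proof.
move=> Zc; pose P (j : int) := c - n%:Z <= j <= c + n%:Z.
pose e j : hom (Z j) (Z j) := if P j then idm (Z j) else 0.
have ee j : e j \oc e j = e j by rewrite /e; case: ifP; rewrite ?mcomp1m ?mcomp0l.
have ded i j l : cd Z j l \oc e j \oc cd Z i j = 0.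
  by rewrite /e; case: ifP; rewrite ?mcompm1 ?cd_sq// mcomp0r mcomp0l.
pose T := retract_complex Asplit ee ded.
have Tbd : bounded T.
  exists (c - n%:Z), (c + n%:Z) => j jP.
  by apply: rc_zero0; rewrite /e ifF//; apply/negP => /andP[]; lia.
have Tc : ~ is_zero (T c).
  apply: contra_not Zc.
  apply: is_zero_retract (rc_out Asplit ee ded c) (rc_in Asplit ee ded c) _.
  by rewrite rc_inout /e ifT// /P; lia.
have [W [i [q [Wind qi Wc]]]] :=
  @indecomposable_retract _ _ Afin (exist _ T Tbd) c Tc.
pose i' : chain_map (sval W) T := i; pose q' : chain_map T (sval W) := q.
have width j : is_zero (sval W j) \/ c - n%:Z < j < c + n%:Z.
  have [Wj|Wj] := pselect (is_zero (sval W j)); first by left.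
  by right; exact: indecomposable_width Wc Wj.
have iZ : forall j l, (rc_in Asplit ee ded l \oc i' l) \oc cd (sval W) j l =
    cd Z j l \oc (rc_in Asplit ee ded j \oc i' j).
  apply: cm_step => j; rewrite -mcompA cmap_comm rc_cd !mcompA rc_inout.
  case: (width j) => [/is_zero_src Wj|jc]; first by rewrite [LHS]Wj [RHS]Wj.
  by rewrite /e ifT ?mcomp1m// /P; lia.
have qZ : forall j l, (q' l \oc rc_out Asplit ee ded l) \oc cd Z j l =
    cd (sval W) j l \oc (q' j \oc rc_out Asplit ee ded j).
  apply: cm_step => j; rewrite mcompA -cmap_comm rc_cd -!mcompA rc_inout.
  case: (width (j + 1)) => [/is_zero_tgt Wj|jc]; first by rewrite [LHS]Wj [RHS]Wj.
  by rewrite /e ifT ?mcompm1// /P; lia.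
exists W, (ChainMap iZ), (ChainMap qZ); split=> //.
apply: chain_map_eq => j /=; rewrite -mcompA (mcompA (rc_out Asplit ee ded j)).
rewrite rc_outin mcomp1m.
exact: (congr1 (fun h : chain_map (sval W) (sval W) => h j) qi).
Qed.

End Truncation.

(** * The compression of indecomposable complexes *)

Section Functors.
Variables (k : comPzRingType) (C D : kcat k) (T : kfunctor C D).

Lemma fmap_sum (X Y : C) (J : Type) (r : seq J) (f : J -> hom X Y) :
  fmap T (\sum_(j <- r) f j) = \sum_(j <- r) fmap T (f j).
Proof.
elim: r => [|j r IH]; first by rewrite !big_nil fmap0.
by rewrite !big_cons -IH; have := fmap_lin T 1 (f j) (\sum_(j <- r) f j); rewrite !scale1r.
Qed.

Lemma fmap_dirsum (I : eqType) (Y : I -> C) X : is_dirsum Y X ->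
  is_dirsum (fun i => T (Y i)) (T X).
Proof.
move=> [d]; constructor.
apply: (@DirSum _ _ _ predT (fun i => T (Y i)) (T X) (fun i => fmap T (ds_inj d i))
  (fun i => fmap T (ds_prj d i)) (ds_supp d) (ds_supp_uniq d)) => //.
- by move=> i _; rewrite -fmapM ds_prj_inj// fmap1.
- by move=> i j _ _ ij; rewrite -fmapM ds_prj_inj0// fmap0.
- under eq_bigr do rewrite -fmapM.
  by rewrite -fmap_sum ds_sum fmap1.
Qed.

Lemma fmap_isom X Y : isom X Y -> isom (T X) (T Y).
Proof.
move=> [f [g [gf fg]]]; exists (fmap T f), (fmap T g).
by rewrite -!fmapM gf fg !fmap1.
Qed.

End Functors.

Section Galois.
Variables (k : comPzRingType) (A : kcat k) (Aadd : is_additive A).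
Hypotheses (Asplit : idem_split A) (Afin : hom_finite A).
Variable m : nat.
Hypothesis m0 : (0 < m)%N.
Implicit Types (X Y V W : bounded_complexes A) (g : int).

Local Notation res := (residue m).
Local Notation CC := (compr_complex Aadd m).
Local Notation F := (compression Aadd m).
Local Notation sh := (shift_action A m).
Local Notation cinj := (@compr_inj k A Aadd m).
Local Notation cprj := (@compr_prj k A Aadd m).
Local Notation Cb := (bounded_complexes A).
Local Notation "g \cc f" := (@mcomp k (complexes A) _ _ _ g f)
  (at level 40, left associativity).
Local Notation sh_in := (sh_in Aadd m).
Local Notation sh_out := (sh_out Aadd m).
Local Notation id_in := (id_in Aadd m).
Local Notation id_out := (id_out Aadd m).

Let Csplit : idem_split Cb := bounded_split Asplit.
Let Cfit : fitting Cb := bounded_fitting Afin Asplit.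

Lemma shift_indec X g : indecomposable X -> indecomposable (sh g X).
Proof.
have zero0 V h : is_zero (sh h V) -> is_zero V.
  move=> /complex_zeroP V0; apply: (proj2 (complex_zeroP (sval V))) => i.
  by have := V0 (i - h * m%:Z); rewrite /= subrK.
move=> [X0 Xind]; split=> [/zero0//|Y /(fmap_dirsum (sh (- g)))].
by rewrite shK => /Xind[] /zero0; [left|right].
Qed.

Lemma sh_in_out g X i :
  (sh_in g X \cc sh_out g X : chain_map (CC X) (CC X)) i =
  cinj X i (i + g * m%:Z) \oc cprj X i (i + g * m%:Z).
Proof.
have signs (S T U : A) c (b : hom T U) (a : hom S T) : c * c = 1 ->
    (c *: b) \oc (c *: a) = b \oc a.
  by move=> cc; rewrite mcompZl mcompZr scalerA cc scale1r.
exact: signs (shift_corrK _ _ _).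
Qed.

Lemma shift_components X V : exists G : seq int, [/\ uniq G, (0 : int) \in G &
  forall f : chain_map (sval V) (CC X),
    f = \sum_(g <- G) sh_in g X \cc sh_out g X \cc f].
Proof.
have [G [uG G1 G0]] := common_degrees m0 V X; exists G; split=> // f.
apply: chain_map_eq => i; rewrite cm_sumE; apply: cprj_ext => j ij.
have [g ->] := residueP (residue_refl m i) ij.
rewrite mcomp_sumr (sum_only (i := g))//.
- rewrite [X in _ = _ \oc X]/(((sh_in g X \cc sh_out g X : chain_map _ _) i) \oc f i).
  by rewrite sh_in_out !mcompA cprj_inj ?residue_shift ?residue_refl// mcomp1m.
- move=> h _ hg.
  rewrite [X in _ \oc X]/(((sh_in h X \cc sh_out h X : chain_map _ _) i) \oc f i).
  rewrite sh_in_out !mcompA cprj_inj0 ?residue_shift ?residue_refl ?mcomp0l//.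
  exact: shift_inj.
- move=> /G0/(_ i)[/is_zero_src|/is_zero_tgt] z; exact: z.
Qed.

(** The component of f of degree 0 in the grading of End (F X) by Hom(X, X[gm]). *)
Definition corner X (f : pmap (F X) (F X)) : @hom k Cb X X := id_out X \cc f \cc id_in X.

Lemma corner0 X : corner (0 : @hom k (periodic_complexes A m) (F X) (F X)) = 0.
Proof.
apply: chain_map_eq => i; rewrite -[LHS]/(cprj X i i \oc 0 \oc cinj X i i).
by rewrite mcomp0r mcomp0l.
Qed.

Lemma corner1 X : corner (idm (F X) : pmap (F X) (F X)) = idm X.
Proof.
apply: chain_map_eq => i; rewrite /= mcompm1.
by rewrite cprj_inj ?residue_refl.
Qed.

(** All the components X[gm] -> X[gm] of f are shifts of the corner of f. *)
Lemma corner_shift X g (f : pmap (F X) (F X)) :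
  @is_iso k Cb (sh g X) (sh g X) (sh_out g X \cc f \cc sh_in g X) -> is_iso (corner f).
Proof.
move=> fiso; apply: bounded_iso => j; rewrite -[j](subrK (g * m%:Z)).
move: (j - g * m%:Z) => i.
pose fg : chain_map (sval (sh g X)) (sval (sh g X)) := sh_out g X \cc f \cc sh_in g X.
have : is_iso (fg i) by exact: cm_iso_deg fiso.
have -> : fg i =
    (corner f : chain_map (sval X) (sval X)) (i + g * m%:Z).
  rewrite [RHS]/= -(@entry_per _ _ _ _ _ _ f i).
    have signs (S T U V : A) c (b : hom T U) (a : hom S T) (d : hom U V) : c * c = 1 ->
      (c *: d) \oc b \oc (c *: a) = d \oc b \oc a.
      by move=> cc; rewrite mcompZr !mcompZl scalerA cc scale1r.
    exact: signs (shift_corrK _ _ _).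
  by rewrite addrC modzMDl.
by [].
Qed.

Lemma id_in_out X : sh_in 0 X \cc sh_out 0 X = id_in X \cc id_out X.
Proof.
apply: chain_map_eq => i; rewrite sh_in_out.
rewrite -[RHS]/(cinj X i i \oc cprj X i i).
have gen j : j = i -> cinj X i j \oc cprj X i j = cinj X i i \oc cprj X i i by move=> ->.
by apply: gen; rewrite mul0r addr0.
Qed.

(** A composition that factors through a shift X[gm] with g <> 0 is not
    invertible, as X is not isomorphic to X[gm]; so corner is multiplicative modulo
    the radical of End X. *)
Lemma corner_mul X (f f' : @hom k (periodic_complexes A m) (F X) (F X)) :
  indecomposable X -> is_iso (corner f) -> is_iso (corner f') ->
  is_iso (corner (f \oc f')).
Proof.
move=> Xind fiso f'iso; apply: contrapT => ff'.
have [G [uG G0 Gsum]] := shift_components X X.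
pose t g : @hom k Cb X X :=
  (id_out X \cc (f : pmap (F X) (F X)) \cc sh_in g X) \cc
  (sh_out g X \cc (f' : pmap (F X) (F X)) \cc id_in X).
have sumt : corner (f \oc f') = \sum_(g <- G) t g.
  rewrite -[LHS]/(id_out X \cc
    ((f : pmap (F X) (F X)) \cc (f' : pmap (F X) (F X))) \cc id_in X).
  rewrite -!mcompA [X in _ \cc (_ \cc X)]Gsum !mcomp_sumr; apply: eq_bigr => g _.
  by rewrite /t -!mcompA.
have t0 : t 0 = @mcomp k Cb X X X (corner f) (corner f').
  rewrite -[RHS]/((id_out X \cc (f : pmap (F X) (F X)) \cc id_in X) \cc
    (id_out X \cc (f' : pmap (F X) (F X)) \cc id_in X)).
  rewrite /t -!mcompA (@mcompA k (complexes A) _ _ _ _ (sh_in 0 X)) id_in_out -!mcompA.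
  by [].
have nt g : g != 0 -> ~ is_iso (t g).
  move=> g0 tiso.
  have [vis _] := retract_indec Csplit (shift_indec g Xind) (proj1 Xind)
    (tiso : is_iso (@mcomp k Cb _ (sh g X) _ _ _)).
  apply: (@shift_free _ _ _ m0 X g 0 Xind g0).
  by rewrite sh0; apply: isom_sym; eexists; exact: vis.
have : is_iso (t 0) by rewrite t0; exact: is_iso_comp.
have -> : t 0 = corner (f \oc f') + \sum_(g <- rem 0 G) - t g.
  by rewrite sumt (big_rem 0 G0)/= -addrA -big_split/= big1 ?addr0// => g _; rewrite subrr.
apply: noniso_add => //; apply: noniso_sum => // g.
by rewrite mem_rem_uniq// inE => /andP[/nt tg _] /is_iso_opp; rewrite opprK.
Qed.

(** As b a = 1, the identity of the summand W of Z also factors through the idempotent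
    a b of F X.  If the corner of a b is not invertible, then no component
    X[gm] -> X[hm] of a b is, and the identity of W is a sum of nonisomorphisms. *)
Lemma corner_retract X (Z : periodic_complexes A m) (a : hom Z (F X)) (b : hom (F X) Z) W
    (i : chain_map (sval W) (Z : pcomplex A m)) (q : chain_map (Z : pcomplex A m) (sval W)) :
  indecomposable X -> indecomposable W -> cm_comp q i = cm_id (sval W) ->
  b \oc a = idm Z -> is_iso (corner (a \oc b)).
Proof.
move=> Xind Wind qi ba; apply: contrapT => ncorner.
pose a' : chain_map (Z : pcomplex A m) (CC X) := pm a.
pose b' : chain_map (CC X) (Z : pcomplex A m) := pm b.
pose e := a' \cc b'.
have ba' : b' \cc a' = idm (Z : complexes A) by exact: (congr1 (@pm _ _ _ _ _) ba).
have qi' : q \cc i = idm (sval W : complexes A) by [].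
have [G [_ _ Gsum]] := shift_components X W.
have nmid g h : ~ @is_iso k Cb (sh g X) (sh h X) (sh_out h X \cc e \cc sh_in g X).
  have [<-|gh] := eqVneq g h; first by move=> /(@corner_shift X g (a \oc b))/ncorner.
  by move=> iso; apply: (shift_free m0 Xind gh); eexists; exact: iso.
suff : ~ is_iso (idm W) by apply; exact: is_iso_idm.
have -> : idm W = \sum_(g <- G)
    (q \cc b' \cc e \cc sh_in g X \cc (sh_out g X \cc (a' \cc i)) : @hom k Cb W W).
  transitivity (q \cc b' \cc e \cc (a' \cc i)).
    rewrite /e -!mcompA (@mcompA k (complexes A) _ _ _ _ b' a' (b' \cc _)) ba'.
    by rewrite mcomp1m (@mcompA k (complexes A) _ _ _ _ b' a') ba' mcomp1m qi'.
  rewrite [X in _ \cc X]Gsum mcomp_sumr; apply: eq_bigr => g _.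
  by rewrite -!mcompA.
apply: noniso_sum => // g _.
have [H [_ _ Hsum]] := shift_components X (sh g X).
have -> : (q \cc b' \cc e \cc sh_in g X \cc (sh_out g X \cc (a' \cc i)) : @hom k Cb W W) =
    \sum_(h <- H) ((q \cc b' \cc sh_in h X) \cc (sh_out h X \cc e \cc sh_in g X)
      \cc (sh_out g X \cc (a' \cc i)) : @hom k Cb W W).
  rewrite -(@mcompA k (complexes A) _ _ _ _ (q \cc b') e) [e \cc _]Hsum mcomp_sumr mcomp_suml.
  by apply: eq_bigr => h _; rewrite -!mcompA.
apply: noniso_sum => // h _.
exact: (@noniso_through k Cb Csplit (sh g X) (sh h X) W _
  (sh_out g X \cc (a' \cc i)) (q \cc b' \cc sh_in h X)
  (shift_indec g Xind) (shift_indec h Xind) Wind (nmid g h)).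
Qed.

(** The identity of X factors through F Y, hence through the sum of the Y[gm]; as
    End X is local, one of the summands of this factorization is invertible. *)
Lemma compression_orbit X Y : indecomposable X -> indecomposable Y ->
  isom (F X) (F Y) -> exists g : zgroup, isom Y (sh g X).
Proof.
move=> Xind Yind [f [f' [f'f _]]].
pose u : chain_map (CC X) (CC Y) := pm f; pose u' : chain_map (CC Y) (CC X) := pm f'.
have u'u : u' \cc u = idm (CC X : complexes A) by exact: (congr1 (@pm _ _ _ _ _) f'f).
have [G [_ _ Gsum]] := shift_components Y X.
pose t g : @hom k Cb X X :=
  (id_out X \cc u' \cc sh_in g Y) \cc (sh_out g Y \cc (u \cc id_in X)).
have sumt : idm X = \sum_(g <- G) t g.
  transitivity (id_out X \cc u' \cc (u \cc id_in X)).
    rewrite -!mcompA (@mcompA k (complexes A) _ _ _ _ u' u) u'u mcomp1m.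
    by rewrite -[LHS](corner1 X) /corner -!mcompA (@mcomp1m k (complexes A)).
  rewrite [X in _ \cc X]Gsum mcomp_sumr; apply: eq_bigr => g _.
  by rewrite /t -!mcompA.
have [g _ tiso] : exists2 g, g \in G & is_iso (t g).
  apply: contrapT => noiso; apply: (@noniso_sum _ _ Cfit X _ G t Xind).
    by move=> g gG tg; apply: noiso; exists g.
  by rewrite -sumt; exact: is_iso_idm.
have [vis _] := retract_indec Csplit (shift_indec g Yind) (proj1 Xind)
    (tiso : is_iso (@mcomp k Cb _ (sh g Y) _ _ _)).
exists (- g); rewrite -[Y in isom Y _](shK m Y g).
by apply: fmap_isom; apply: isom_sym; eexists; exact: vis.
Qed.

Hypothesis summand : forall (Z : complex A) (c : int), ~ is_zero (Z c) ->
  exists (W : Cb) (i : chain_map (sval W) Z) (q : chain_map Z (sval W)),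
    indecomposable W /\ cm_comp q i = cm_id (sval W).

Lemma periodic_summand (Z : periodic_complexes A m) : ~ is_zero Z ->
  exists (W : Cb) (i : chain_map (sval W) (Z : pcomplex A m))
    (q : chain_map (Z : pcomplex A m) (sval W)),
    indecomposable W /\ cm_comp q i = cm_id (sval W).
Proof.
move=> Z0; have [c Zc] : exists c, ~ is_zero ((Z : pcomplex A m) c).
  apply: contrapT => /forallNP Zz; apply: Z0; apply: pmap_eq; apply: chain_map_eq => c.
  exact: contrapT (Zz c).
exact: summand Zc.
Qed.

Lemma compression_nonzero X : ~ is_zero X -> ~ is_zero (F X).
Proof. by move=> X0 FX0; apply: X0; rewrite /is_zero -corner1 FX0 corner0. Qed.

(** If F X = Z + Z', the idempotents of both summands have invertible corners;
    so does their product, which is 0. *)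
Lemma compression_indec X : indecomposable X -> indecomposable (F X).
Proof.
move=> Xind; split; first exact: compression_nonzero (proj1 Xind).
move=> Y [d]; apply: contrapT => /not_orP[Yt Yf].
have corner_s s : is_iso (corner (ds_inj d s \oc ds_prj d s)).
  have [W [i [q [Wind qi]]]] : exists (W : Cb) (i : chain_map (sval W) (Y s : pcomplex A m))
    (q : chain_map (Y s : pcomplex A m) (sval W)),
    indecomposable W /\ cm_comp q i = cm_id (sval W).
    by apply: periodic_summand; case: s.
  by apply: (corner_retract Xind Wind qi); exact: ds_prj_inj.
have := corner_mul Xind (corner_s true) (corner_s false).
rewrite -mcompA (mcompA (ds_prj d true)) ds_prj_inj0// mcomp0l mcomp0r corner0.
by move=> /is_zero_iso0; case: Xind.
Qed.

(** ** Adjunction *)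

(** Total in S and T, so that a sum over a residue class needs no proof that its terms
    Z^j are equal; the value 0 is never met there. *)
Definition objcast (S T : A) : hom S T :=
  if pselect (S = T) is left e then hcast erefl e (idm S) else 0.

Lemma objcast_id S : objcast S S = idm S.
Proof.
rewrite /objcast; case: pselect => // e.
by rewrite (Prop_irrelevance e erefl).
Qed.

Lemma objcast_nat (S T S' T' : A) (d : hom S T) (d' : hom S' T') :
  Arrow d = Arrow d' -> objcast T T' \oc d = d' \oc objcast S S'.
Proof.
move=> /ArrowP[eS [eT ->]]; case: _ / eS d'; case: _ / eT => _ /=.
by rewrite !objcast_id mcomp1m mcompm1.
Qed.

Section Adjunction.
Variables (W : Cb) (Z : pcomplex A m).

(** The compression is both a left and a right adjoint of the functor that forgets
    periodicity; these are the morphisms adjoint to i : W -> Z and q : Z -> W. *)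
Definition adj_in_deg (i : chain_map (sval W) Z) (P : pred int) (T : A) :
    hom (compr_sum Aadd W P) T :=
  \sum_(j <- ds_supp (compr_ds Aadd W P))
    objcast (Z j) T \oc i j \oc ds_prj (compr_ds Aadd W P) j.

Definition adj_out_deg (q : chain_map Z (sval W)) (P : pred int) (T : A) :
    hom T (compr_sum Aadd W P) :=
  \sum_(j <- ds_supp (compr_ds Aadd W P))
    ds_inj (compr_ds Aadd W P) j \oc (q j \oc objcast T (Z j)).

Lemma adj_in_inj i r j : res r j ->
  (adj_in_deg i (res r) (Z r) : hom (CC W r) (Z r)) \oc cinj W r j =
  objcast (Z j) (Z r) \oc i j.
Proof. by move=> rj; exact: (sum_prj_inj _ (fun j => objcast (Z j) (Z r) \oc i j)). Qed.

Lemma adj_out_prj q r j : res r j ->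
  cprj W r j \oc (adj_out_deg q (res r) (Z r) : hom (Z r) (CC W r)) =
  q j \oc objcast (Z r) (Z j).
Proof. by move=> rj; exact: (prj_sum_inj _ (fun j => q j \oc objcast (Z r) (Z j))). Qed.

Lemma adj_in (i : chain_map (sval W) Z) :
  exists u : pmap (F W) Z, forall r, u r \oc cinj W r r = i r.
Proof.
pose u r : hom (CC W r) (Z r) := adj_in_deg i (res r) (Z r).
have comm : forall r l, u l \oc cd (CC W) r l = cd Z r l \oc u r.
  apply: cm_step => r; apply: cinj_ext => j rj.
  rewrite -mcompA (@cd_cinj k A Aadd m W r j _ rj (erefl _)) mcompA adj_in_inj -?residueS//.
  rewrite -mcompA cmap_comm -mcompA adj_in_inj// !mcompA; congr (_ \oc _).
  by apply: objcast_nat; apply: pc_per; exact/eqP.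
have per (r r' : int) : (r = r' %[mod m])%Z -> Arrow (u r) = Arrow (u r').
  move=> rr'.
  have gen P P' T T' : P = P' -> T = T' ->
    Arrow (adj_in_deg i P T) = Arrow (adj_in_deg i P' T') by move=> -> ->.
  exact: gen (residue_eq rr') (pc_obj Z rr').
exists (@PMap _ _ _ (F W) Z (@ChainMap _ _ (CC W) Z u comm) per) => r /=.
by rewrite adj_in_inj ?residue_refl// objcast_id mcomp1m.
Qed.

Lemma adj_out (q : chain_map Z (sval W)) :
  exists v : pmap Z (F W), forall r, cprj W r r \oc v r = q r.
Proof.
pose v r : hom (Z r) (CC W r) := adj_out_deg q (res r) (Z r).
have comm : forall r l, v l \oc cd Z r l = cd (CC W) r l \oc v r.
  apply: cm_step => r; apply: cprj_ext => j; rewrite -[j](subrK 1) -residueS => rj.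
  rewrite mcompA adj_out_prj -?residueS// mcompA.
  rewrite (@cprj_cd k A Aadd m W r (j - 1) _ rj (erefl _)).
  rewrite -(mcompA (cd _ _ _)) adj_out_prj// mcompA -cmap_comm -!mcompA; congr (_ \oc _).
  by apply: objcast_nat; apply: pc_per; apply/esym/eqP.
have per (r r' : int) : (r = r' %[mod m])%Z -> Arrow (v r) = Arrow (v r').
  move=> rr'.
  have gen P P' T T' : P = P' -> T = T' ->
    Arrow (adj_out_deg q P T) = Arrow (adj_out_deg q P' T') by move=> -> ->.
  exact: gen (residue_eq rr') (pc_obj Z rr').
exists (@PMap _ _ _ Z (F W) (@ChainMap _ _ Z (CC W) v comm) per) => r /=.
by rewrite adj_out_prj ?residue_refl// objcast_id mcompm1.
Qed.

End Adjunction.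

(** A bounded indecomposable summand W of Z yields F W -> Z -> F W.  The corner of this
    composition psi is 1, so psi is not nilpotent; as F W is indecomposable, psi
    is invertible, and F W is a summand of Z. *)
Lemma compression_dense : almost_dense F.
Proof.
move=> Z Zind; have [W [i [q [Wind qi]]]] := periodic_summand (proj1 Zind).
have [u uE] := adj_in i; have [v vE] := adj_out q.
exists W; exists u.
have W0 := compression_nonzero (proj1 Wind).
pose psi : @hom k (periodic_complexes A m) (F W) (F W) :=
  @mcomp k (periodic_complexes A m) _ _ _ v u.
have psi1 : corner psi = idm W.
  apply: chain_map_eq => r; rewrite -[LHS]/(cprj W r r \oc (v r \oc u r) \oc cinj W r r).
  rewrite mcompA vE -mcompA uE.
  exact: (congr1 (fun h : chain_map _ _ => h r) qi).
have corner_pow a : is_iso (corner (mpow psi a)).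
  elim: a => [|a IH]; first by rewrite corner1; exact: is_iso_idm.
  by apply: corner_mul => //; rewrite psi1; exact: is_iso_idm.
case: (periodic_fitting Afin m0 Asplit psi (compression_indec Wind)) => [|[a psia0]].
  by move=> /(retract_indec (periodic_split Asplit (m := m)) Zind W0)[].
have := corner_pow a; rewrite psia0 corner0 => /is_zero_iso0.
by case: Wind.
Qed.

End Galois.

Theorem theorem3p2 (k : comPzRingType) (A : kcat k) (Aadd : is_additive A)
    (Ahom : hom_finite A) (Aks : krull_schmidt A)
    (n : nat) (hn : (2 <= n)%N)
    (Hind : forall X : bounded_complexes A, indecomposable X ->
       exists (Y : complexes_1n A n) (t : int),
         indecomposable Y /\ isom X (shift A t (sval Y)))
    (m : nat) (hm : (0 < m)%N) :
  galois_covering (shift_action A m) (compression Aadd m).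
Proof.
have Asplit := krull_schmidt_split Aadd Aks.
have summand := bounded_summand Asplit Ahom Hind.
split.
- exact: shift_admissible.
- exact: compression_precovering.
- exact: compression_dense summand.
- exact: compression_indec summand.
- exact: compression_orbit.
Qed.
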